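(* Let $P=\{p_1,\dots,p_n\}\subset\mathbb{R}^2$ be in general position and let $f_{ij}=\det(a,p_i,p_j)\det(b,p_i,p_j)$ for fixed $a,b\in\mathbb{R}^2$. Let $Y\subset\mathbb{R}^{\binom n2}$, with coordinates $d_{ij}=d_{ji}$, be defined by: for every four distinct indices $i,j,k,l$, $\sum w_{\alpha\beta}d_{\alpha\beta}=1$, the sum over the six pairs $\alpha\beta$ from $\{i,j,k,l\}$, with $w_{\alpha\beta}=1/(\det(p_\alpha,p_\beta,p_\gamma)\det(p_\alpha,p_\beta,p_\delta))$ where $\{\gamma,\delta\}=\{i,j,k,l\}\setminus\{\alpha,\beta\}$; and $d_{ij}\le0$ for all pairs. Then $Y$ is a simple polyhedron, affinely isomorphic to $\bar X_f(P)$ via $v\mapsto d$, $d_{ij}=f_{ij}-\langle p_i-p_j,v_i-v_j\rangle$. Its unique maximal bounded face is obtained by setting $d_{ij}=0$ for all convex hull edges $ij$ of $P$, and this face is affinely isomorphic to $X_f(P)$.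
   Context: General position: no three points collinear. $\det(q_0,q_1,q_2)$ is the determinant of the $3\times3$ matrix with columns $(q_0,1),(q_1,1),(q_2,1)$. Infinitesimal motions $v\in(\mathbb{R}^2)^n$ are normalized by $v_1^1=v_1^2=v_2^1=0$ (with $p_1,p_2$ having different $y$-coordinates). $\bar X_f(P)$ is the set of normalized $v$ with $\langle p_i-p_j,v_i-v_j\rangle\ge f_{ij}$ for all $i<j$; $X_f(P)$ is its subset where the inequalities for the convex hull edges of $P$ hold with equality. *)

(* Defs.v *)
From HB Require Import structures.
From mathcomp Require Import all_boot all_order all_algebra.
From mathcomp Require Import reals.
Set Implicit Arguments. Unset Strict Implicit. Unset Printing Implicit Defensive.
Import Order.TTheory GRing.Theory Num.Theory.
Local Open Scope ring_scope.

Section Defs.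
Variable R : realType.

Definition pt := (R * R)%type.

Definition dot (u w : pt) : R := u.1 * w.1 + u.2 * w.2.
Definition psub (u w : pt) : pt := (u.1 - w.1, u.2 - w.2).

Definition det3 (q0 q1 q2 : pt) : R :=
  \det (\matrix_(r < 3, c < 3)
          (let q := nth q0 [:: q0; q1; q2] c in
           nth 1 [:: q.1; q.2; 1] r)).

Definition general_position n (p : 'I_n -> pt) : Prop :=
  forall i j k : 'I_n, i != j -> j != k -> i != k -> det3 (p i) (p j) (p k) != 0.

(* ij is an edge of the convex hull of P (for points in general position):
   all the other points lie strictly on one side of the line p_i p_j. *)
Definition hull_edge n (p : 'I_n -> pt) (i j : 'I_n) : Prop :=
  i != j /\
  ((forall k, k != i -> k != j -> 0 < det3 (p i) (p j) (p k)) \/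
   (forall k, k != i -> k != j -> det3 (p i) (p j) (p k) < 0)).

(* Unordered pairs {i,j} represented as i < j: coordinates of R^(n choose 2). *)
Definition pairs n := {ij : 'I_n * 'I_n | (ij.1 < ij.2)%N}.
Definition pfst n (e : pairs n) : 'I_n := (val e).1.
Definition psnd n (e : pairs n) : 'I_n := (val e).2.

Definition coords n := pairs n -> R.

(* symmetric accessor d_{ij} = d_{ji} (0 on the diagonal, which is never used) *)
Definition dd n (d : coords n) (i j : 'I_n) : R :=
  if (insub (i, j) : option (pairs n)) is Some e then d e
  else if (insub (j, i) : option (pairs n)) is Some e then d e else 0.

Definition fab n (a b : pt) (p : 'I_n -> pt) (i j : 'I_n) : R :=
  det3 a (p i) (p j) * det3 b (p i) (p j).

Definition motion n := 'I_n -> pt.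

Definition stretch n (p : 'I_n -> pt) (v : motion n) (i j : 'I_n) : R :=
  dot (psub (p i) (p j)) (psub (v i) (v j)).

(* normalization v_1^1 = v_1^2 = v_2^1 = 0 (indices 1,2 are ord0, 1 here) *)
Definition normalized n (v : motion n.+2) : Prop :=
  (v ord0).1 = 0 /\ (v ord0).2 = 0 /\ (v (lift ord0 ord0)).1 = 0.

Definition Xbar n (a b : pt) (p : 'I_n.+2 -> pt) (v : motion n.+2) : Prop :=
  normalized v /\ forall e : pairs n.+2,
    fab a b p (pfst e) (psnd e) <= stretch p v (pfst e) (psnd e).

Definition Xf n (a b : pt) (p : 'I_n.+2 -> pt) (v : motion n.+2) : Prop :=
  Xbar a b p v /\ forall e : pairs n.+2, hull_edge p (pfst e) (psnd e) ->
    stretch p v (pfst e) (psnd e) = fab a b p (pfst e) (psnd e).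

Definition phi n (a b : pt) (p : 'I_n -> pt) (v : motion n) : coords n :=
  fun e => fab a b p (pfst e) (psnd e) - stretch p v (pfst e) (psnd e).

Definition wgt n (p : 'I_n -> pt) (al be ga de : 'I_n) : R :=
  (det3 (p al) (p be) (p ga) * det3 (p al) (p be) (p de))^-1.

Definition Yset n (p : 'I_n -> pt) (d : coords n) : Prop :=
  (forall i j k l : 'I_n, uniq [:: i; j; k; l] ->
     wgt p i j k l * dd d i j + wgt p i k j l * dd d i k +
     wgt p i l j k * dd d i l + wgt p j k i l * dd d j k +
     wgt p j l i k * dd d j l + wgt p k l i j * dd d k l = 1) /\
  (forall e : pairs n, d e <= 0).

Definition psubset n (A B : coords n -> Prop) := forall x, A x -> B x.

Definition is_polyhedron n (Y : coords n -> Prop) : Prop :=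
  exists (m : nat) (A : 'I_m -> coords n) (c : 'I_m -> R),
    forall x, Y x <-> (forall r, \sum_(e : pairs n) A r e * x e <= c r).

(* faces: intersections with supporting hyperplanes (including Y and the empty set) *)
Definition is_face n (Y F : coords n -> Prop) : Prop :=
  exists (c : coords n) (c0 : R),
    (forall x, Y x -> \sum_(e : pairs n) c e * x e <= c0) /\
    F = (fun x => Y x /\ \sum_(e : pairs n) c e * x e = c0).

Definition bounded n (F : coords n -> Prop) : Prop :=
  exists M : R, forall x, F x -> forall e, `|x e| <= M.

Definition aff_indep n m (x : 'I_m.+1 -> coords n) : Prop :=
  forall c : 'I_m.+1 -> R, \sum_i c i = 0 ->
    (forall e, \sum_i c i * x i e = 0) -> forall i, c i = 0.

Definition affdim n (S : coords n -> Prop) (k : nat) : Prop :=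
  (exists x : 'I_k.+1 -> coords n, (forall i, S (x i)) /\ aff_indep x) /\
  (forall m (x : 'I_m.+1 -> coords n), (forall i, S (x i)) -> aff_indep x -> (m <= k)%N).

Definition is_vertex n (Y : coords n -> Prop) (x : coords n) : Prop :=
  is_face Y (fun y => y = x).

Definition is_facet n (Y F : coords n -> Prop) : Prop :=
  is_face Y F /\ exists k, affdim Y k.+1 /\ affdim F k.

Definition simple_polyhedron n (Y : coords n -> Prop) : Prop :=
  is_polyhedron Y /\
  forall k, affdim Y k -> forall x, is_vertex Y x ->
    exists F : 'I_k -> (coords n -> Prop),
      injective F /\ (forall i, is_facet Y (F i) /\ F i x) /\
      (forall G, is_facet Y G -> G x -> exists i, G = F i).

Definition bounded_face n (Y F : coords n -> Prop) := is_face Y F /\ bounded F.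

End Defs.

(* Main.v *)
(* The tight pairs of a point [d] of [Y], together with the hull edges, form a
   noncrossing graph in which no vertex lies inside a triangle of neighbours: in the
   relation [sum w d = 1] of a crossing, or of such a triangle, the tight coordinates
   are those with negative weight, which leaves a nonpositive sum.  Such a graph
   carries no self-stress.  Lift the plane by the Maxwell-Cremona surface of the
   stress; above a highest vertex chosen rightmost, the surface descends strictly both
   upwards and downwards, so that neither angle over or under the vertex is reflex
   and three neighbours surround it.  Hence every prescription of values on the tight
   pairs and hull edges is realised by a motion.

   This makes [Y] locally a simplicial cone at each vertex, so simple.  It also lets
   one start at a point of a face where a hull coordinate is negative and decrease
   that coordinate while keeping the tight ones, so a bounded face lies in [F].
   Finally [F] is bounded because wheels with hub at an inner point, or at the
   centroid with the hub eliminated, give self-stresses that are negative on the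
   pairs in question. *)
Require Import Defs.
From HB Require Import structures.
From mathcomp Require Import all_boot all_order all_algebra.
From mathcomp Require Import reals.
From mathcomp Require Import boolp ring lra.
Set Implicit Arguments. Unset Strict Implicit. Unset Printing Implicit Defensive.
Import Order.TTheory GRing.Theory Num.Theory.
Local Open Scope ring_scope.

(** * Self-stresses of noncrossing pointed graphs *)

(** No faces of the drawn graph are ever formed. Just over a point the Maxwell lift is the total
    moment of the stressed edges that pass higher, so it is a finite sum over edges, and equilibrium
    makes this sum independent of the vertical line as long as it is taken over the same edge.
    Vertical lines must meet vertices one at a time; a shear achieves this and changes no
    determinant. Only the values of the lift at vertices are compared, and breaking ties to the
    right makes one comparison strict. The argument bounds elevations from above; run for [w] and
    for [- w], it makes them all vanish, and the two highest edges at a leftmost stressed vertex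
    then give the contradiction.

    Both facts about faces rest on one property: at every point of [Y] the tight and hull
    coordinates of a direction can be prescribed freely. At a vertex the tight coordinates moreover
    determine the direction, so they are linear coordinates on the directions. *)

Lemma det3E (R : realType) (q0 q1 q2 : pt R) :
  det3 q0 q1 q2 =
  (q1.1 - q0.1) * (q2.2 - q0.2) - (q2.1 - q0.1) * (q1.2 - q0.2).
Proof.
rewrite /det3 (expand_det_row _ ord0) !big_ord_recl big_ord0 /cofactor.
rewrite !(expand_det_row _ ord0) !big_ord_recl !big_ord0 /cofactor !det_mx11 !mxE /=.
by rewrite /bump /=; ring.
Qed.

Section Graphs.
Variables (R : realType) (I : finType) (p : I -> pt R).
Local Notation det i j k := (det3 (p i) (p j) (p k)).

(** [det3 a (p i) (p j)] is the cross product of [p i - a] with [p j - p i], so zero moment about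
    every [a] is force balance at [i], in the form that the lift sums up. *)
Definition equilibrium (w : I -> I -> R) :=
  forall i a, \sum_j w i j * det3 a (p i) (p j) = 0.

Definition noncrossing (w : I -> I -> R) := forall i j k l, uniq [:: i; j; k; l] ->
  w i j != 0 -> w k l != 0 ->
  det i j k * det i j l < 0 -> det k l i * det k l j < 0 -> False.

Definition pointed (w : I -> I -> R) := forall i j k l,
  w i j != 0 -> w i k != 0 -> w i l != 0 ->
  0 < det i j k -> 0 < det i k l -> 0 < det i l j -> False.
End Graphs.

(** * The Maxwell lift along vertical lines *)

Section Lifting.
Variables (R : realType) (I : finType) (p : I -> pt R) (w : I -> I -> R).
Local Notation x i := (p i).1.
Local Notation y i := (p i).2.
Local Notation det i j k := (det3 (p i) (p j) (p k)).
Hypothesis xinj : injective (fun i => x i).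
Hypothesis gp : forall i j k, i != j -> j != k -> i != k -> det i j k != 0.
Hypothesis wsym : forall i j, w i j = w j i.
Hypothesis equi : equilibrium p w.
Hypothesis ncw : noncrossing p w.

Lemma x_lt_neq i j : x i < x j -> i != j.
Proof. by apply: contraTneq => ->; rewrite ltxx. Qed.

Definition height m l s := y m + (y l - y m) * (s - x m) / (x l - x m).

Definition edge m l := (x m < x l) && (w m l != 0).

Definition moment a m l := w m l * det3 a (p m) (p l).

Lemma x_neq i j : i != j -> x i != x j.
Proof. by apply: contra => /eqP /xinj ->. Qed.

Lemma det_height m l a : x m < x l ->
  det3 (p m) (p l) a = (x l - x m) * (a.2 - height m l a.1).
Proof. by move=> ml; rewrite det3E /height; field; lra. Qed.

Lemma det_on_edge m l s q r : x m < x l ->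
  (x l - x m) * det3 q r (s, height m l s) =
  (x l - s) * det3 q r (p m) + (s - x m) * det3 q r (p l).
Proof. by move=> ml; rewrite !det3E /height /=; field; lra. Qed.

Lemma height_left m l : height m l (x m) = y m.
Proof. by rewrite /height subrr mulr0 mul0r addr0. Qed.

Lemma height_right m l : x m < x l -> height m l (x l) = y l.
Proof. by move=> ml; rewrite /height; field; lra. Qed.

Lemma opposite_signs (a b u v : R) :
  0 < a -> 0 < b -> u != 0 -> v != 0 -> a * u + b * v = 0 -> u * v < 0.
Proof.
move=> a0 b0 u0 v0 e.
have v2 : 0 < b * v ^+ 2 by rewrite mulr_gt0 // exprn_even_gt0.
rewrite -(pmulr_rlt0 _ a0) mulrA.
have -> : a * u = - (b * v) by lra.
by rewrite mulNr oppr_lt0 -mulrA -expr2.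
Qed.

(** A common point over [s] would put the ends of each edge on opposite sides of the other, which is
    a crossing; for edges sharing an endpoint it would contradict general position. *)
Lemma heights_neq j k m l s : edge j k -> edge m l -> (m, l) != (j, k) ->
  x j < s < x k -> x m < s < x l -> height m l s != height j k s.
Proof.
move=> /andP[jk wjk] /andP[ml wml] ne /andP[js sk] /andP[ms sl].
apply/eqP => e.
have d1 : det3 (p j) (p k) (s, height j k s) = 0 by rewrite det_height //= subrr mulr0.
have d2 : det3 (p m) (p l) (s, height m l s) = 0 by rewrite det_height //= subrr mulr0.
have := det_on_edge s (p j) (p k) ml; rewrite e d1 mulr0 => /esym e1.
have := det_on_edge s (p m) (p l) jk; rewrite -e d2 mulr0 => /esym e2.
have jl : j != l by apply: contraTN sl => /eqP <-; lra.
have km : k != m by apply: contraTN ms => /eqP <-; lra.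
have njk : j != k by apply: contraTN jk => /eqP <-; rewrite ltxx.
have nml : m != l by apply: contraTN ml => /eqP <-; rewrite ltxx.
have [jm|jm] := eqVneq j m.
  subst m; have kl : k != l by apply: contraNneq ne => ->.
  move: e1; have -> : det j k j = 0 by rewrite det3E; ring.
  rewrite mulr0 add0r => /eqP; rewrite mulf_eq0 (negbTE (gp njk kl jl)) orbF; lra.
have [kl|kl] := eqVneq k l.
  subst l; move: e1; have -> : det j k k = 0 by rewrite det3E; ring.
  rewrite mulr0 addr0 => /eqP; rewrite mulf_eq0 (negbTE (gp njk km jm)) orbF; lra.
apply: (ncw (i := j) (j := k) (k := m) (l := l)) => //.
- by rewrite /= !inE !negb_or njk jm jl km kl nml.
- by apply: opposite_signs e1; rewrite ?subr_gt0 // gp.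
- apply: opposite_signs e2; rewrite ?subr_gt0 // gp //; by rewrite eq_sym.
Qed.

(* Noncrossing edges keep their vertical order on the overlap of their spans, so it may be
   read off at the midpoint. *)
Definition meet_mid j k m l := (Num.max (x j) (x m) + Num.min (x k) (x l)) / 2.

Definition above m l j k :=
  height j k (meet_mid j k m l) < height m l (meet_mid j k m l).

Lemma affine_sign (u v lo hi s1 s2 : R) :
  (forall s, lo < s < hi -> u + v * s != 0) ->
  lo <= s1 <= hi -> lo < s2 < hi -> 0 < u + v * s1 -> 0 < u + v * s2.
Proof.
move=> nz b1 b2 pos; rewrite lt_neqAle eq_sym nz //= leNgt; apply/negP => neg.
have v0 : v != 0 by apply/eqP => v0; rewrite v0 in pos neg; lra.
have := nz (- u / v); have -> : u + v * (- u / v) = 0 by field.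
rewrite eqxx => /(_ _)/negP; apply => //.
have [vp|vn] := ltP 0 v.
  have : s2 < - u / v by rewrite ltr_pdivlMr //; lra.
  have : - u / v < s1 by rewrite ltr_pdivrMr //; lra.
  lra.
have {}vn : v < 0 by lra.
have : - u / v < s2 by rewrite ltr_ndivrMr //; lra.
have : s1 < - u / v by rewrite ltr_ndivlMr //; lra.
lra.
Qed.

(** By [affine_sign] the order may be tested at any common abscissa, ends included, where the
    heights differ. At a shared endpoint they agree, hence the midpoint in the definition. *)
Lemma above_at j k m l s : edge j k -> edge m l -> (m, l) != (j, k) ->
  Num.max (x j) (x m) < Num.min (x k) (x l) ->
  x j <= s <= x k -> x m <= s <= x l ->
  height m l s != height j k s ->
  above m l j k = (height j k s < height m l s).
Proof.
move=> ejk eml ne ov s1 s2 hn.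
pose u := height m l 0 - height j k 0.
pose v := (y l - y m) / (x l - x m) - (y k - y j) / (x k - x j).
have jk : x j < x k by case/andP: ejk.
have ml : x m < x l by case/andP: eml.
have uv t : height m l t - height j k t = u + v * t.
  by rewrite /u /v /height; field; lra.
have nz t : Num.max (x j) (x m) < t < Num.min (x k) (x l) -> u + v * t != 0.
  rewrite gt_max lt_min => /andP[/andP[a1 a2] /andP[a3 a4]].
  by rewrite -uv subr_eq0; apply: heights_neq => //; rewrite ?a1 ?a2.
have sb : Num.max (x j) (x m) <= s <= Num.min (x k) (x l).
  by rewrite ge_max le_min; case/andP: s1 => -> ->; case/andP: s2 => -> ->.
have mb : Num.max (x j) (x m) < meet_mid j k m l < Num.min (x k) (x l).
  by rewrite /meet_mid; apply/andP; split; lra.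
rewrite /above -subr_gt0 -[RHS]subr_gt0 !uv.
have [sp|sn] := ltP 0 (u + v * s).
  exact: (affine_sign nz sb mb sp).
have {}sn : 0 < (- u) + (- v) * s.
  have : u + v * s != 0 by rewrite -uv subr_eq0.
  by rewrite neq_lt => /orP[]; lra.
have nz' t : Num.max (x j) (x m) < t < Num.min (x k) (x l) -> (- u) + (- v) * t != 0.
  by move=> /nz; rewrite mulNr -opprD oppr_eq0.
have := affine_sign nz' sb mb sn.
by move=> h; apply/negbTE; rewrite -leNgt; lra.
Qed.

Lemma aboveNN j k : above j k j k = false.
Proof. by rewrite /above ltxx. Qed.

Lemma above_at_vertex j k m l v : edge j k -> edge m l -> v \in [:: m; l] ->
  x j < x v < x k -> above m l j k = (0 < det j k v).
Proof.
move=> ejk eml vml /andP[jv vk].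
have jk : x j < x k by case/andP: ejk.
have ml : x m < x l by case/andP: eml.
have nvj : v != j by apply: contraTN jv => /eqP->; rewrite ltxx.
have nvk : v != k by apply: contraTN vk => /eqP->; rewrite ltxx.
have njk : j != k by apply: contraTN jk => /eqP->; rewrite ltxx.
have dn : det j k v != 0 by rewrite gp // eq_sym.
have hv : height m l (x v) = y v.
  move: vml; rewrite !inE => /orP[]/eqP ->; first exact: height_left.
  exact: height_right.
have dE : (0 < det j k v) = (height j k (x v) < height m l (x v)).
  by rewrite det_height // pmulr_rgt0 ?subr_gt0 // hv.
rewrite dE; apply: above_at => //.
- apply: contraTneq vml => -[-> ->]; by rewrite !inE negb_or nvj nvk.
- move: vml; rewrite !inE => /orP[]/eqP vE; subst v; rewrite gt_max !lt_min;
  by apply/andP; split; apply/andP; split => //; lra.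
- lra.
- move: vml; rewrite !inE => /orP[]/eqP vE; subst v; lra.
- apply: contraNneq dn => hh; rewrite det_height // -hh hv subrr mulr0 //.
Qed.

Definition cut (sg : pred I) := forall m l, x m < x l -> sg l -> sg m.

(* The affine function that the Maxwell lift follows just over the edge [j k]; every cut
   separating [j] from [k] gives the same function, see [plane_cut]. *)
Definition plane (sg : pred I) j k a :=
  \sum_m \sum_l [&& sg m, ~~ sg l, edge m l & above m l j k]%:R * moment a m l.

Lemma momentC a m l : moment a m l = - moment a l m.
Proof. by rewrite /moment wsym !det3E; ring. Qed.

(* Equilibrium summed over [V]: the edges inside [V] cancel. *)
Lemma equi_sum (V : pred I) a :
  \sum_m \sum_l (edge m l)%:R * ((V l)%:R - (V m)%:R) * moment a m l = 0.
Proof.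
transitivity (- \sum_m (V m)%:R * \sum_l moment a m l); last first.
  by rewrite big1 ?oppr0 // => m _; rewrite /moment equi mulr0.
transitivity (\sum_m \sum_l ((edge m l)%:R * (V l)%:R * moment a m l) -
    \sum_m \sum_l ((edge m l)%:R * (V m)%:R * moment a m l)).
  rewrite -sumrB; apply: eq_bigr => m _; rewrite -sumrB; apply: eq_bigr => l _; ring.
rewrite exchange_big /= -sumrB -sumrN; apply: eq_bigr => m _.
rewrite -sumrB mulr_sumr -sumrN; apply: eq_bigr => l _.
rewrite (momentC a l m) /edge.
have [->|ne] := eqVneq l m.
  have -> : moment a m m = 0 by rewrite /moment det3E; ring.
  by rewrite ltxx; ring.
have := x_neq ne; rewrite neq_lt (wsym l m) => /orP[lt|lt]; rewrite lt.
  rewrite (ltNge (x m)) (ltW lt) /=; case: eqP => [w0|_] /=; last by ring.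
  by rewrite /moment w0; ring.
rewrite (ltNge (x l)) (ltW lt) /=; case: eqP => [w0|_] /=; last by ring.
by rewrite /moment w0; ring.
Qed.

Lemma plane_cut (sg sg' : pred I) j k a : edge j k -> cut sg -> cut sg' ->
  (forall i, sg i -> sg' i) -> sg j -> ~~ sg' k ->
  plane sg j k a = plane sg' j k a.
Proof.
move=> ejk csg csg' sub sj sk; apply/eqP; rewrite -subr_eq0; apply/eqP.
(* The vertices between the two cuts and above [j k]. An edge with an end between the cuts lies
   above [j k] exactly when that end does, so the two planes differ by a sum that [equi_sum] makes
   zero. *)
rewrite -(equi_sum (fun i => [&& sg' i, ~~ sg i & 0 < det j k i]) a).
rewrite /plane -sumrB; apply: eq_bigr => m _; rewrite -sumrB; apply: eq_bigr => l _.
rewrite -mulrBl; congr (_ * _).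
case eml : (edge m l); rewrite /= ?andbF ?mul0r ?subrr // mul1r.
have ml : x m < x l by case/andP: eml.
have mid v : sg' v -> ~~ sg v -> x j < x v < x k.
  move=> v1 v2; apply/andP; split; rewrite lt_neqAle.
    rewrite x_neq; last by apply: contraNneq v2 => <-.
    by rewrite leNgt; apply: contra v2 => /csg; apply.
  rewrite x_neq; last by apply: contraTneq v1 => ->.
  by rewrite leNgt; apply: contra sk => /csg'; apply.
have abm : sg' m -> ~~ sg m -> above m l j k = (0 < det j k m).
  by move=> m1 m2; apply: above_at_vertex => //; rewrite ?inE ?eqxx // mid.
have abl : sg' l -> ~~ sg l -> above m l j k = (0 < det j k l).
  by move=> m1 m2; apply: above_at_vertex => //; rewrite ?inE ?eqxx ?orbT // mid.
move: abm abl (csg _ _ ml) (csg' _ _ ml) (sub m) (sub l).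
move: (above m l j k) (0 < det j k m) (0 < det j k l).
case: (sg m) (sg' m) (sg l) (sg' l) => [] [] [] [] ab dm dl h1 h2 h3 h4 h5 h6 /=;
  rewrite ?subrr //; try (by have := h3 isT); try (by have := h4 isT);
  try (by have := h5 isT); try (by have := h6 isT);
  rewrite -?h1 // -?h2 // ?subrr ?subr0 ?sub0r //.
Qed.

(* The Maxwell lift near [p i], on the vertical line over [p i]. *)
Definition upper i a :=
  \sum_m \sum_l [&& x m < x i < x l, edge m l & det m l i < 0]%:R * moment a m l.

Definition elevation i := upper i (p i).

(** Edges starting at [j] have no moment about [p j]; the others over [p j] are above [j k] exactly
    when they pass above [p j]. *)
Lemma plane_left j k : edge j k ->
  plane (fun i => x i <= x j) j k (p j) = elevation j.
Proof.
move=> ejk; apply: eq_bigr => m _; apply: eq_bigr => l _.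
have jk : x j < x k by case/andP: ejk.
have [<-|jm] := eqVneq j m.
  have -> : moment (p j) j l = 0 by rewrite /moment det3E; ring.
  by rewrite !mulr0.
congr ((nat_of_bool _)%:R * _); case eml : (edge m l); rewrite ?andbF //= -ltNge.
have ml : x m < x l by case/andP: eml.
rewrite le_eqVlt eq_sym (negbTE (x_neq jm)) /=.
have [mj|] //= := ltP (x m) (x j); have [jl|] //= := ltP (x j) (x l).
have njl : j != l by apply: contraTneq jl => <-; rewrite ltxx.
have nml : m != l by apply: contraTneq ml => <-; rewrite ltxx.
have dn : det m l j != 0 by rewrite gp // eq_sym.
rewrite (above_at (s := x j)) //.
- by rewrite height_left det_height // pmulr_rlt0 ?subr_gt0 // subr_lt0.
- by apply: contraNneq jm => -[-> _].
- by rewrite gt_max !lt_min; apply/andP; split; apply/andP; split => //; lra.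
- by rewrite lexx ltW.
- by rewrite !ltW.
- by apply: contraNneq dn; rewrite height_left det_height // => ->; rewrite subrr mulr0.
Qed.

Lemma plane_right j k : edge j k ->
  plane (fun i => x i < x k) j k (p k) = elevation k.
Proof.
move=> ejk; apply: eq_bigr => m _; apply: eq_bigr => l _.
have jk : x j < x k by case/andP: ejk.
have [<-|kl] := eqVneq k l.
  have -> : moment (p k) m k = 0 by rewrite /moment det3E; ring.
  by rewrite !mulr0.
congr ((nat_of_bool _)%:R * _); case eml : (edge m l); rewrite ?andbF //= -leNgt.
have ml : x m < x l by case/andP: eml.
rewrite le_eqVlt (negbTE (x_neq kl)) /=.
have [mk|] //= := ltP (x m) (x k); have [lk|] //= := ltP (x k) (x l).
have nkm : k != m by apply: contraTneq mk => <-; rewrite ltxx.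
have nml : m != l by apply: contraTneq ml => <-; rewrite ltxx.
have dn : det m l k != 0 by rewrite gp // eq_sym.
rewrite (above_at (s := x k)) //.
- by rewrite height_right // det_height // pmulr_rlt0 ?subr_gt0 // subr_lt0.
- by apply: contraNneq kl => -[_ ->].
- by rewrite gt_max !lt_min; apply/andP; split; apply/andP; split => //; lra.
- by rewrite lexx ltW.
- by rewrite !ltW.
- by apply: contraNneq dn; rewrite height_right // det_height // => ->; rewrite subrr mulr0.
Qed.

Lemma cut_lt t : cut (fun i => x i < t).
Proof. by move=> m l /lt_trans; apply. Qed.

Lemma cut_le t : cut (fun i => x i <= t).
Proof. by move=> m l /ltW /le_trans; apply. Qed.

Lemma planeE sg j k a : edge j k -> cut sg -> sg j -> ~~ sg k ->
  plane sg j k a = plane (fun i => x i <= x j) j k a.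
Proof.
move=> ejk csg sj sk; have jk : x j < x k by case/andP: ejk.
apply/esym; apply: plane_cut => //; first exact: cut_le.
move=> i; rewrite le_eqVlt => /orP[/eqP/xinj -> //|]; by move=> /csg; apply.
Qed.

(** With its counterpart at [k], this is continuity of the lift: all its pieces along edges share
    the elevations of the vertices as values. *)
Lemma plane_at_left sg j k : edge j k -> cut sg -> sg j -> ~~ sg k ->
  plane sg j k (p j) = elevation j.
Proof. by move=> *; rewrite planeE // plane_left. Qed.

Lemma plane_at_right sg j k : edge j k -> cut sg -> sg j -> ~~ sg k ->
  plane sg j k (p k) = elevation k.
Proof.
move=> ejk *; have jk : x j < x k by case/andP: ejk.
by rewrite planeE // -(plane_right ejk) [RHS]planeE ?ltxx //; apply: cut_lt.
Qed.

Definition slope i k := (y k - y i) / (x k - x i).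

Lemma above_slope i k l : x i < x k -> x i < x l ->
  above i l i k = (slope i k < slope i l).
Proof.
move=> ik il; rewrite /above.
have h c : x i < x c -> height i c (meet_mid i k i l) =
    y i + slope i c * (meet_mid i k i l - x i).
  by move=> ic; rewrite /height /slope mulrAC.
rewrite !h // ltrD2l ltr_pM2r // subr_gt0 /meet_mid maxxx.
by rewrite ltr_pdivlMr // mulr_natr mulr2n ltrD2l lt_min ik.
Qed.

(** No edge leaving [i] to the right is steeper than [i k], so the edges above [i k] just right of
    [p i] are those passing over [p i]. *)
Lemma upper_right i k a : edge i k ->
  (forall l, edge i l -> slope i l <= slope i k) ->
  upper i a = plane (fun v => x v <= x i) i k a.
Proof.
move=> eik top; apply: eq_bigr => m _; apply: eq_bigr => l _; congr ((nat_of_bool _)%:R * _).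
have ik : x i < x k by case/andP: eik.
case eml : (edge m l); rewrite ?andbF //= -ltNge.
have ml : x m < x l by case/andP: eml.
have [im|im] := eqVneq i m.
  by subst m; rewrite ltxx lexx ml above_slope // [slope i k < _]ltNge top.
rewrite [x m <= _]le_eqVlt [x m == _]eq_sym (negbTE (x_neq im)) /=.
have [mi|] //= := ltP (x m) (x i); have [il|] //= := ltP (x i) (x l).
have nil : i != l by apply: contraTneq il => <-; rewrite ltxx.
have nml : m != l by apply: contraTneq ml => <-; rewrite ltxx.
have dn : det m l i != 0 by rewrite gp // eq_sym.
rewrite (above_at (s := x i)) //.
- by rewrite height_left det_height // pmulr_rlt0 ?subr_gt0 // subr_lt0.
- by apply: contraNneq im => -[-> _].
- by rewrite gt_max !lt_min; apply/andP; split; apply/andP; split => //; lra.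
- by rewrite lexx ltW.
- by rewrite !ltW.
- by apply: contraNneq dn; rewrite height_left det_height // => ->; rewrite subrr mulr0.
Qed.

(** To the left of [i] the highest edge is the one of least slope. *)
Lemma upper_left i k a : edge k i ->
  (forall l, edge l i -> slope i k <= slope i l) ->
  upper i a = plane (fun v => x v < x i) k i a.
Proof.
move=> eki top; apply: eq_bigr => m _; apply: eq_bigr => l _; congr ((nat_of_bool _)%:R * _).
have ki : x k < x i by case/andP: eki.
case eml : (edge m l); rewrite ?andbF //= -leNgt.
have ml : x m < x l by case/andP: eml.
have [il|il] := eqVneq i l.
  subst l; rewrite ltxx lexx ml /=; apply/esym/negbTE; rewrite -leNgt.
  have h c : x c < x i -> height c i (meet_mid k i m i) =
     y i + slope i c * (meet_mid k i m i - x i).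
    by move=> ic; rewrite /height /slope; field; lra.
  rewrite !h // lerD2l ler_wnM2r ?top // subr_le0 /meet_mid minxx.
  by rewrite ler_pdivrMr // mulr_natr mulr2n lerD2r ge_max !ltW.
rewrite [x i <= _]le_eqVlt (negbTE (x_neq il)) /=.
have [mi|] //= := ltP (x m) (x i); have [iltl|] //= := ltP (x i) (x l).
have nim : i != m by apply: contraTneq mi => <-; rewrite ltxx.
have nml : m != l by apply: contraTneq ml => <-; rewrite ltxx.
have dn : det m l i != 0 by rewrite gp // eq_sym.
rewrite (above_at (s := x i)) //.
- by rewrite height_right // det_height // pmulr_rlt0 ?subr_gt0 // subr_lt0.
- by apply: contraNneq il => -[_ ->].
- by rewrite gt_max !lt_min; apply/andP; split; apply/andP; split => //; lra.
- by rewrite lexx ltW.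
- by rewrite !ltW.
- by apply: contraNneq dn; rewrite height_right // det_height // => ->; rewrite subrr mulr0.
Qed.

(* Crossing upwards the lowest edge over [p i]. *)
Lemma upper_next i j k a : edge j k -> x j < x i < x k -> det j k i < 0 ->
  (forall m l, edge m l -> x m < x i < x l -> det m l i < 0 ->
     height j k (x i) <= height m l (x i)) ->
  upper i a = moment a j k + plane (fun v => x v <= x i) j k a.
Proof.
move=> ejk /[dup] ijk /andP[ji ik] djk low.
have jk : x j < x k by case/andP: ejk.
rewrite /upper /plane pair_big /= [X in _ = _ + X]pair_big /=.
rewrite (bigD1 (j, k)) //= [X in _ = _ + X](bigD1 (j, k)) //=.
rewrite ijk ejk djk aboveNN !andbF mul0r add0r mul1r; congr (_ + _).
apply: eq_bigr => -[m l] /= ne; congr ((nat_of_bool _)%:R * _).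
case eml : (edge m l); rewrite ?andbF //= -ltNge.
have ml : x m < x l by case/andP: eml.
have yi : y i < height j k (x i).
  by move: djk; rewrite det_height // pmulr_rlt0 ?subr_gt0 // subr_lt0.
have [il|il] := ltP (x i) (x l); last by rewrite !andbF.
rewrite andbT; have [im|im] := eqVneq i m.
  subst m; rewrite ltxx lexx; apply/esym/negbTE.
  rewrite (above_at (s := x i)) ?height_left -?leNgt ?lexx ?ltW ?lt_eqF //.
  by rewrite gt_max !lt_min jk ik il (lt_trans ji il).
rewrite [x m <= _]le_eqVlt [x m == _]eq_sym (negbTE (x_neq im)) /=.
have [mi|] //= := ltP (x m) (x i).
have hn : height m l (x i) != height j k (x i) by apply: heights_neq => //; apply/andP.
rewrite (above_at (s := x i)) ?ltW //.
  rewrite det_height // pmulr_rlt0 ?subr_gt0 // subr_lt0.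
  apply/idP/idP; last exact: lt_trans.
  move=> h; rewrite lt_neqAle eq_sym hn low //; first by rewrite mi.
  by rewrite det_height // pmulr_rlt0 ?subr_gt0 // subr_lt0.
by rewrite gt_max !lt_min; apply/andP; split; apply/andP; split => //; lra.
Qed.

Lemma upper_affine i : exists c : R * R * R,
  forall a, upper i a = c.1.1 + c.1.2 * a.1 + c.2 * a.2.
Proof.
pose b m l : R := [&& x m < x i < x l, edge m l & det m l i < 0]%:R * w m l.
exists (\sum_m \sum_l b m l * (x m * y l - x l * y m),
        \sum_m \sum_l b m l * (y m - y l), \sum_m \sum_l b m l * (x l - x m)) => a /=.
rewrite !mulr_suml -!big_split; apply: eq_bigr => m _ /=.
rewrite !mulr_suml -!big_split; apply: eq_bigr => l _ /=.
by rewrite /moment /b; move: (nat_of_bool _) => B; rewrite det3E; ring.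
Qed.

Lemma moment_left j k : moment (p j) j k = 0.
Proof. by rewrite /moment det3E; ring. Qed.

Lemma moment_right j k : moment (p k) j k = 0.
Proof. by rewrite /moment det3E; ring. Qed.

Lemma affine_height (c : R * R * R) j k s : x j < x k ->
  (x k - x j) * (c.1.1 + c.1.2 * s + c.2 * height j k s) =
  (x k - s) * (c.1.1 + c.1.2 * x j + c.2 * y j) +
  (s - x j) * (c.1.1 + c.1.2 * x k + c.2 * y k).
Proof. by move=> jk; rewrite /height; field; lra. Qed.

Section Summit.
Variable i : I.
Hypothesis max_elevation : forall j, elevation j <= elevation i.
Hypothesis rightmost : forall j, elevation j = elevation i -> x j <= x i.
Hypothesis elevation_neq0 : elevation i != 0.

(** The piece of the lift over [p i] ends at the lowest edge [j k] passing there. On that edge it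
    takes a weighted mean of the elevations of [j] and [k], strictly less than that of [i] because
    [k] lies further right; so the vertical slope [c.2] is negative. *)
Lemma upper_descends (c : R * R * R) :
  (forall a, upper i a = c.1.1 + c.1.2 * a.1 + c.2 * a.2) -> c.2 < 0.
Proof.
move=> cE.
pose over (e : I * I) :=
  [&& edge e.1 e.2, x e.1 < x i < x e.2 & det e.1 e.2 i < 0].
have [e0 oe0|none] := pickP over; last first.
  case/eqP: elevation_neq0; rewrite /elevation /upper big1 // => m _; rewrite big1 // => l _.
  by have := none (m, l); rewrite /over /= andbCA => ->; rewrite mul0r.
case: (arg_minP (fun e : I * I => height e.1 e.2 (x i)) oe0) => -[j k] /= /and3P[ejk ijk djk] low.
have nxt : forall a, upper i a = moment a j k + plane (fun v => x v <= x i) j k a.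
  move=> a; apply: upper_next => // m l eml iml dml; apply: (low (m, l)).
  by rewrite /over /= eml iml dml.
have /andP[ji ik] := ijk.
have jk : x j < x k by case/andP: ejk.
have Ej : upper i (p j) = elevation j.
  rewrite nxt moment_left add0r plane_at_left //; [exact: cut_le|exact: ltW|].
  by rewrite -ltNge.
have Ek : upper i (p k) = elevation k.
  rewrite nxt moment_right add0r plane_at_right //; [exact: cut_le|exact: ltW|].
  by rewrite -ltNge.
have hk : elevation k < elevation i.
  rewrite lt_neqAle max_elevation andbT; apply/eqP => /rightmost; lra.
have hj := max_elevation j.
have := affine_height c (x i) jk.
rewrite -cE Ej -cE Ek.
have := cE (p i); rewrite -/(elevation i) => Ei.
have yi : y i < height j k (x i).
  by move: djk; rewrite det_height // pmulr_rlt0 ?subr_gt0 // subr_lt0.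
have -> : c.1.1 + c.1.2 * x i + c.2 * height j k (x i) =
  elevation i + c.2 * (height j k (x i) - y i) by rewrite Ei; ring.
move=> E.
have : (x k - x j) * (c.2 * (height j k (x i) - y i)) < 0.
  have h1 : 0 <= (x k - x i) * (elevation i - elevation j) by apply: mulr_ge0; lra.
  have h2 : 0 < (x i - x j) * (elevation i - elevation k) by apply: mulr_gt0; lra.
  lra.
by rewrite pmulr_rlt0 ?subr_gt0 // pmulr_llt0 // subr_gt0.
Qed.

(** Take the topmost edges at [i] on both sides. The piece over [p i] has the elevations of [j] and
    [k] at their ends, so on the segment between these ends, over [x i], it is at most the elevation
    of [i]. As it descends upwards, the segment passes over [p i]. *)
Lemma upper_reflex j0 k0 : edge j0 i -> edge i k0 ->
  exists j k, [/\ edge j i, edge i k & det j k i < 0].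
Proof.
move=> ej0 ek0.
case: (@arg_minP _ _ _ j0 (fun l => edge l i) (slope i) ej0) => j eji topj.
case: (@arg_maxP _ _ _ k0 (fun l => edge i l) (slope i) ek0) => k eik topk.
exists j, k; split=> //.
have ji : x j < x i by case/andP: eji.
have ik : x i < x k by case/andP: eik.
have jk : x j < x k by lra.
have [c cE] := upper_affine i.
have c2 := upper_descends cE.
have Ek : upper i (p k) = elevation k.
  rewrite (upper_right _ eik) // plane_at_right //; first exact: cut_le.
  by rewrite -ltNge.
have Ej : upper i (p j) = elevation j.
  rewrite (upper_left _ eji) // plane_at_left ?ltxx //; exact: cut_lt.
have Ei := cE (p i); rewrite -/(elevation i) in Ei.
have := affine_height c (x i) jk; rewrite -cE Ej -cE Ek.
have hj := max_elevation j; have hk := max_elevation k.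
have -> : c.1.1 + c.1.2 * x i + c.2 * height j k (x i) =
  elevation i + c.2 * (height j k (x i) - y i) by rewrite Ei; ring.
move=> E.
have : (x k - x j) * (c.2 * (height j k (x i) - y i)) <= 0.
  have h1 : 0 <= (x k - x i) * (elevation i - elevation j) by apply: mulr_ge0; lra.
  have h2 : 0 <= (x i - x j) * (elevation i - elevation k) by apply: mulr_ge0; lra.
  lra.
rewrite pmulr_rle0 ?subr_gt0 // nmulr_rle0 // subr_ge0 => le.
have ji' := x_lt_neq ji; have ik' := x_lt_neq ik; have jk' := x_lt_neq jk.
have dn : det j k i != 0 by rewrite gp // eq_sym.
by rewrite lt_neqAle dn det_height // pmulr_rle0 ?subr_gt0 // subr_le0.
Qed.
End Summit.

Definition lower i a :=
  \sum_m \sum_l [&& x m < x i < x l, edge m l & 0 < det m l i]%:R * moment a m l.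

Lemma span_split i m l : edge m l -> x m < x i < x l ->
  (det m l i < 0) = ~~ (0 < det m l i).
Proof.
move=> /andP[ml _] /andP[mi il]; rewrite -leNgt [RHS]le_eqVlt.
have mi' := x_lt_neq mi; have il' := x_lt_neq il; have ml' := x_lt_neq ml.
by rewrite (negbTE (gp _ _ _)) // eq_sym.
Qed.

(** The stressed edges meeting a vertical line just left of [p i] have total moment zero: this is
    [equi_sum] for the points left of the line. *)
Lemma balance_left i a :
  upper i a + lower i a + \sum_m (edge m i)%:R * moment a m i = 0.
Proof.
apply: oppr_inj; rewrite oppr0 -[RHS](equi_sum (fun v => x v < x i) a).
rewrite /upper /lower -!big_split -sumrN; apply: eq_bigr => m _ /=.
rewrite -big_split /= (bigD1 i) //= [in RHS](bigD1 i) //= ltxx andbF /=.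
rewrite addrAC opprD -sumrN; congr (_ + _).
  case eml : (edge m i); last by rewrite /=; ring.
  by have /andP[-> _] := eml; rewrite /=; ring.
apply: eq_bigr => l li; case eml : (edge m l); last by rewrite /= !andbF !mul0r; ring.
have ml : x m < x l by case/andP: eml.
case h: (x m < x i < x l).
  have /andP[mi il] := h.
  by rewrite /= (span_split eml h) mi (ltNge (x l)) (ltW il) /=; case: (0 < _) => /=; ring.
move: h; have := x_neq li; rewrite neq_lt; case: (ltP (x l)) => [li' _|_ /= il].
  by rewrite (lt_trans ml li') /= => _; ring.
by rewrite il andbT => -> /=; ring.
Qed.

Lemma balance_right i a :
  upper i a + lower i a + \sum_l (edge i l)%:R * moment a i l = 0.
Proof.
have e1 := balance_left i a.
have e2 : \sum_l moment a i l = 0 by rewrite /moment equi.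
suff e3 : \sum_l (edge i l)%:R * moment a i l - \sum_l (edge l i)%:R * moment a l i =
          \sum_l moment a i l by lra.
rewrite -sumrB; apply: eq_bigr => l _; rewrite (momentC _ l) /edge (wsym l).
have [->|ne] := eqVneq l i; first by rewrite ltxx /= /moment det3E; ring.
have := x_neq ne; rewrite neq_lt => /orP[lt|lt]; rewrite lt.
  by rewrite (ltNge (x i)) (ltW lt) /=; case: eqP => [w0|_] /=; rewrite /moment ?w0; ring.
by rewrite (ltNge (x l)) (ltW lt) /=; case: eqP => [w0|_] /=; rewrite /moment ?w0; ring.
Qed.

(** Edges ending at [i] have no moment about [p i], so the lift can equally be computed from below.
    This makes elevations invariant under reflection. *)
Lemma elevation_lower i : elevation i = - lower i (p i).
Proof.
have := balance_left i (p i); rewrite -/(elevation i) [X in _ + X]big1; first lra.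
by move=> m _; rewrite moment_right mulr0.
Qed.

(** With edges on at most one side of [i], the lift over and under [p i] is a single affine
    function, which cannot descend in both directions. *)
Lemma upper_one_sided i a :
  (forall l, ~~ edge l i) \/ (forall l, ~~ edge i l) -> upper i a = - lower i a.
Proof.
case=> none.
  have := balance_left i a; rewrite [X in _ + X]big1; first lra.
  by move=> m _; rewrite (negbTE (none m)) mul0r.
have := balance_right i a; rewrite [X in _ + X]big1; first lra.
by move=> m _; rewrite (negbTE (none m)) mul0r.
Qed.
End Lifting.

(** * Reflection in the horizontal axis *)

Definition flip (R : realType) (a : pt R) : pt R := (a.1, - a.2).
Arguments flip {R} a.

Lemma flipK (R : realType) : involutive (@flip R).
Proof. by case=> a b; rewrite /flip /= opprK. Qed.

Section Reflection.
Variables (R : realType) (I : finType) (p : I -> pt R) (w : I -> I -> R).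

Lemma det3_flip (a b c : pt R) : det3 (flip a) (flip b) (flip c) = - det3 a b c.
Proof. by rewrite !det3E /=; ring. Qed.

Lemma upper_flip i a : upper (fun v => flip (p v)) w i (flip a) = - lower p w i a.
Proof.
rewrite /upper /lower -sumrN; apply: eq_bigr => m _; rewrite -sumrN; apply: eq_bigr => l _.
by rewrite /moment /edge /= !det3_flip oppr_lt0 !mulrN.
Qed.
End Reflection.

(** * No vertex has positive elevation *)

Section NoSummit.
Variables (R : realType) (I : finType) (p : I -> pt R) (w : I -> I -> R).
Local Notation x i := (p i).1.
Local Notation det i j k := (det3 (p i) (p j) (p k)).
Hypothesis xinj : injective (fun i => x i).
Hypothesis gp : forall i j k, i != j -> j != k -> i != k -> det i j k != 0.
Hypothesis wsym : forall i j, w i j = w j i.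
Hypothesis equi : equilibrium p w.
Hypothesis ncw : noncrossing p w.
Hypothesis ptw : pointed p w.

Lemma elevation_flip i : elevation (fun v => flip (p v)) w i = elevation p w i.
Proof. by rewrite /elevation upper_flip -elevation_lower. Qed.

Lemma flip_gp i j k : i != j -> j != k -> i != k ->
  det3 ((fun v => flip (p v)) i) ((fun v => flip (p v)) j) ((fun v => flip (p v)) k) != 0.
Proof. by move=> *; rewrite det3_flip oppr_eq0 gp. Qed.

Lemma flip_equi : equilibrium (fun v => flip (p v)) w.
Proof.
move=> i a; have /eqP := equi i (flip a); rewrite -oppr_eq0 -sumrN => /eqP e0.
rewrite -[RHS]e0; apply: eq_bigr => j _; rewrite -mulrN -det3_flip.
by rewrite flipK.
Qed.

Lemma flip_noncrossing : noncrossing (fun v => flip (p v)) w.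
Proof. by move=> i j k l; rewrite /= !det3_flip !mulrNN; apply: ncw. Qed.

Lemma elevation_le0 i : elevation p w i <= 0.
Proof.
pose M := [arg max_(j > i) elevation p w j]%O.
have maxM j : elevation p w j <= elevation p w M.
  by rewrite /M; case: arg_maxP => // k _; apply.
apply: le_trans (maxM i) _; move: M maxM => {i} M maxM.
case: (@arg_maxP _ _ _ M (fun j => elevation p w j == elevation p w M) (fun j => x j) (eqxx _)).
move=> i /eqP iM imax; rewrite -iM leNgt; apply/negP => pos.
have {}maxM j : elevation p w j <= elevation p w i by rewrite iM.
have right j : elevation p w j = elevation p w i -> x j <= x i.
  by rewrite iM => /eqP; apply: imax.
have neq0 : elevation p w i != 0 by rewrite gt_eqF.
have maxM' j : elevation (fun v => flip (p v)) w j <= elevation (fun v => flip (p v)) w i.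
  by rewrite !elevation_flip.
have right' j : elevation (fun v => flip (p v)) w j = elevation (fun v => flip (p v)) w i ->
    ((fun v => flip (p v)) j).1 <= ((fun v => flip (p v)) i).1.
  by rewrite !elevation_flip; apply: right.
have neq0' : elevation (fun v => flip (p v)) w i != 0 by rewrite elevation_flip.
have xinj' : injective (fun i => ((fun v => flip (p v)) i).1) by [].
have sides : (exists j, edge p w j i) /\ (exists k, edge p w i k).
  apply: contrapT => one.
  have {}one : (forall l, ~~ edge p w l i) \/ (forall l, ~~ edge p w i l).
    apply: contrapT => h; apply: one; split; apply: contrapT => h'; apply: h;
    [left|right] => l; apply/negP => hl; apply: h'; by exists l.
  have [c cE] := upper_affine p w i.
  have c2 := upper_descends xinj gp wsym equi ncw maxM right neq0 cE.
  have [c' cE'] := upper_affine (fun v => flip (p v)) w i.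
  have c2' := upper_descends xinj' flip_gp wsym flip_equi flip_noncrossing maxM' right' neq0' cE'.
  (* The reflected piece is the same affine function, so [c'.2 = - c.2], although both are
     negative. *)
  have E a : c'.1.1 + c'.1.2 * a.1 - c'.2 * a.2 = c.1.1 + c.1.2 * a.1 + c.2 * a.2.
    rewrite -cE (upper_one_sided xinj gp wsym equi a one) -upper_flip cE' /=; ring.
  by have := E (0, 0); have := E (0, 1) => /=; lra.
have [[j0 ej0] [k0 ek0]] := sides.
have [j [k [eji eik djk]]] := upper_reflex xinj gp wsym equi ncw maxM right neq0 ej0 ek0.
have [j' [k' [eji' eik' ]]] :=
  upper_reflex xinj' flip_gp wsym flip_equi flip_noncrossing maxM' right' neq0' ej0 ek0.
rewrite /= det3_flip oppr_lt0 => djk'.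
have wl l : edge p w l i -> w i l != 0 by rewrite wsym => /andP[].
have wr l : edge p w i l -> w i l != 0 by case/andP.
have [ji xj'] : x j < x i /\ x j' < x i by case/andP: eji eji' => + _ /andP[].
have [ik xk'] : x i < x k /\ x i < x k' by case/andP: eik eik' => + _ /andP[].
have dn : det j' k i != 0.
  have ? := x_lt_neq xj'; have ? := x_lt_neq ik.
  by apply: gp => //; [apply: (@x_lt_neq _ _ p); lra|rewrite eq_sym].
have cyc a b c : det a b c = det b c a by rewrite !det3E; ring.
have anti a b c : det a b c = - det a c b by rewrite !det3E; ring.
(* The segment from [p j'] to [p k] passes over or under [p i]; the third surrounding neighbour is
   [k'] in the first case and [j] in the second. *)
have [neg|pos'] := ltP (det j' k i) 0.
  have d1 : 0 < det i k j' by rewrite anti oppr_gt0 cyc.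
  have d2 : 0 < det i j' k' by rewrite cyc.
  apply: (ptw (wr _ eik) (wl _ eji') (wr _ eik') d1 d2).
  have : 0 < (x i - x j') * det i k' k.
    have -> : (x i - x j') * det i k' k =
      (x k' - x i) * det i k j' + (x k - x i) * det i j' k' by rewrite !det3E; ring.
    by apply: addr_gt0; apply: mulr_gt0; rewrite // subr_gt0.
  by rewrite pmulr_rgt0 // subr_gt0.
have {}pos' : 0 < det i j' k by rewrite cyc lt_neqAle eq_sym dn.
have d1 : 0 < det i k j by rewrite anti oppr_gt0 cyc.
apply: (ptw (wr _ eik) (wl _ eji) (wl _ eji') d1 _ pos').
have : 0 < (x k - x i) * det i j j'.
  have -> : (x k - x i) * det i j j' =
    (x i - x j) * det i j' k + (x i - x j') * det i k j by rewrite !det3E; ring.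
  by apply: addr_gt0; apply: mulr_gt0; rewrite // subr_gt0.
by rewrite pmulr_rgt0 // subr_gt0.
Qed.
End NoSummit.

(** * Vanishing of the stress *)

Section StressFreeX.
Variables (R : realType) (I : finType) (p : I -> pt R) (w : I -> I -> R).
Local Notation x i := (p i).1.
Local Notation y i := (p i).2.
Local Notation det i j k := (det3 (p i) (p j) (p k)).
Hypothesis xinj : injective (fun i => x i).
Hypothesis gp : forall i j k, i != j -> j != k -> i != k -> det i j k != 0.
Hypothesis wsym : forall i j, w i j = w j i.
Hypothesis equi : equilibrium p w.
Hypothesis ncw : noncrossing p w.
Hypothesis ptw : pointed p w.

Lemma elevation_eq0 i : elevation p w i = 0.
Proof.
apply/eqP; rewrite eq_le elevation_le0 //= -oppr_le0.
have -> : - elevation p w i = elevation p (fun i j => - w i j) i.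
  rewrite /elevation /upper -sumrN; apply: eq_bigr => m _.
  rewrite -sumrN; apply: eq_bigr => l _.
  by rewrite /moment /edge oppr_eq0 mulNr mulrN.
apply: elevation_le0 => //.
- by move=> j k; rewrite wsym.
- move=> j a; have /eqP := equi j a; rewrite -oppr_eq0 -sumrN => /eqP e0.
  by rewrite -[RHS]e0; apply: eq_bigr => k _; rewrite mulNr.
- by move=> j k l m; rewrite !oppr_eq0; apply: ncw.
- by move=> j k l m; rewrite !oppr_eq0; apply: ptw.
Qed.

(** At a leftmost stressed vertex [i] all edges go right. If [i k] and [i l] are the two highest,
    [i k] alone counts in the plane of [i l], so the elevation of [l], which is zero, is the moment
    of [i k] about [p l]. *)
Lemma stress_free_distinct_x i j : i != j -> w i j = 0.
Proof.
move=> nij; apply/eqP/negPn/negP => wij.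
pose P u := [exists v, (v != u) && (w u v != 0)].
have Pi : P i by apply/existsP; exists j; rewrite eq_sym nij.
case: (@arg_minP _ _ _ i P (fun u => x u) Pi) => {wij nij Pi}i /existsP[j0 /andP[nj0 wj0]] imin.
have right l : l != i -> w i l != 0 -> edge p w i l.
  move=> li wl; rewrite /edge wl andbT lt_neqAle (@x_neq _ _ p) // 1?eq_sym // imin //.
  by apply/existsP; exists i; rewrite eq_sym li wsym.
case: (@arg_maxP _ _ _ j0 (edge p w i) (slope p i) (right _ nj0 wj0)) => k eik topk.
have /andP[ik wik] := eik.
have [l0 /andP[nlk eil0]|none] := pickP (fun l => (l != k) && edge p w i l); last first.
  (* A single force is not balanced: take moments about a point straight above [p i]. *)
  have := equi i (x i, y i + 1); rewrite (bigD1 k) //= big1.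
    rewrite addr0 det3E /= => /eqP; rewrite mulf_eq0 (negbTE wik) /=; lra.
  move=> l lk; have [->|li] := eqVneq l i; first by rewrite det3E; ring.
  have := none l; rewrite lk /=; case: (eqVneq (w i l) 0) => [-> _|wl]; first by rewrite mul0r.
  by rewrite right.
have l0P : (l0 != k) && edge p w i l0 by rewrite nlk.
case: (@arg_maxP _ _ _ l0 (fun l => (l != k) && edge p w i l) (slope p i) l0P)
  => l /andP[lk eil] topl.
have /andP[il wil] := eil.
have : plane p w (fun v => x v <= x i) i l (p l) = elevation p w l.
  by apply: plane_at_right => //; [exact: cut_le|rewrite -ltNge].
have nik := x_lt_neq ik; have nil := x_lt_neq il.
rewrite elevation_eq0 /plane (bigD1 i) //= [X in _ + X]big1 ?addr0; last first.
  move=> m mi; rewrite big1 // => v _; case: (boolP [&& _, _, _ & _]) => [/and4P[le _ /andP[mv wmv] _]|_];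
    last by rewrite mul0r.
  have : x i <= x m by apply: imin; apply/existsP; exists v; rewrite wmv eq_sym (x_lt_neq mv).
  by move=> ge; case/eqP: mi; apply: xinj; apply/eqP; rewrite eq_le le.
rewrite (bigD1 k) //= big1 ?addr0; last first.
  move=> v vk; case: (boolP [&& _, _, _ & _]) => [/and4P[_ _ eiv]|_]; last by rewrite mul0r.
  have /andP[iv _] := eiv.
  have sv : slope p i v <= slope p i l by apply: topl; rewrite vk.
  by rewrite above_slope // ltNge sv.
have sl : slope p i l <= slope p i k by apply: topk.
rewrite lexx -ltNge ik eik above_slope // lt_neqAle sl andbT.
suff -> : slope p i l != slope p i k.
  rewrite mul1r => /eqP; rewrite mulf_eq0 (negbTE wik) (negbTE (gp _ _ _)) //.
  by rewrite eq_sym.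
apply: contra (gp nil lk nik); rewrite /slope => /eqP e; rewrite det3E.
have e1 : y l - y i = (y k - y i) / (x k - x i) * (x l - x i) by rewrite -e; field; lra.
by rewrite e1; apply/eqP; field; lra.
Qed.
End StressFreeX.

Definition shear (R : realType) (t : R) (a : pt R) : pt R := (a.1 + t * a.2, a.2).

Lemma det3_shear (R : realType) (t : R) (a b c : pt R) :
  det3 (shear t a) (shear t b) (shear t c) = det3 a b c.
Proof. by rewrite !det3E /=; ring. Qed.

Lemma shear_distinct (R : realType) (I : finType) (p : I -> pt R) : injective p ->
  exists t, injective (fun i => (shear t (p i)).1).
Proof.
move=> pinj; pose r (e : I * I) :=
  `|((p e.2).1 - (p e.1).1) / ((p e.1).2 - (p e.2).2)|.
(* Larger than every parameter at which two points of different heights get the same abscissa; pairs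
   of equal height contribute 0, the value of division by zero. *)
pose t := 1 + \sum_e r e; exists t => i j /= e; apply: pinj.
suff e2 : (p i).2 = (p j).2.
  by move: e; rewrite e2 => /addIr e1; rewrite [LHS]surjective_pairing e1 e2 -surjective_pairing.
apply/eqP/negPn/negP => ne.
have tE : t = ((p j).1 - (p i).1) / ((p i).2 - (p j).2).
  have : (p i).2 - (p j).2 != 0 by rewrite subr_eq0.
  move=> n0; apply: (mulIf n0); rewrite divfK //; lra.
have : r (i, j) < t.
  rewrite /t (bigD1 (i, j)) //= addrCA ltrDl.
  by rewrite ltr_wpDr // sumr_ge0 // => *; rewrite normr_ge0.
by rewrite /r /= -tE ltNge ler_norm.
Qed.

Theorem stress_free (R : realType) (I : finType) (p : I -> pt R) (w : I -> I -> R) :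
  injective p ->
  (forall i j k, i != j -> j != k -> i != k -> det3 (p i) (p j) (p k) != 0) ->
  (forall i j, w i j = w j i) -> equilibrium p w -> noncrossing p w -> pointed p w ->
  forall i j, i != j -> w i j = 0.
Proof.
move=> pinj gp ws eq nc pw i j nij.
have [t tinj] := shear_distinct pinj.
apply: (stress_free_distinct_x (p := fun i => shear t (p i))) nij => //.
- by move=> *; rewrite det3_shear; apply: gp.
- move=> u a; have <- : shear t (shear (- t) a) = a.
    by case: a => a1 a2; rewrite /shear /=; congr pair; ring.
  by under eq_bigr do rewrite det3_shear.
- by move=> a b c d; rewrite !det3_shear; apply: nc.
- by move=> a b c d; rewrite !det3_shear; apply: pw.
Qed.

(** * Polyhedra with independent tight constraints *)

Lemma small_scale (R : realType) (I : finType) (P : pred I) (a b : I -> R) :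
  (forall i, P i -> 0 < a i) ->
  exists2 eps, 0 < eps & forall i, P i -> eps * b i < a i.
Proof.
move=> a0; pose s := 1 + \sum_(i | P i) `|b i| / a i.
have s0 : 0 < s by rewrite ltr_pwDl // sumr_ge0 // => i /a0 ai; rewrite divr_ge0 // ltW.
exists s^-1 => [|i Pi]; first by rewrite invr_gt0.
have ai := a0 i Pi; rewrite mulrC ltr_pdivrMr //.
apply: le_lt_trans (ler_norm _) _; rewrite -ltr_pdivrMl // mulrC /s (bigD1 i) //=.
rewrite addrCA ltrDl ltr_wpDr // sumr_ge0 // => j /andP[/a0 aj _].
by rewrite divr_ge0 // ltW.
Qed.

Section Polyhedron.
Variables (R : realType) (n : nat) (Y L : coords R n -> Prop).
Variable H : pairs n -> Prop.
Hypothesis L0 : L (fun=> 0).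
Hypothesis LD : forall c g h, L g -> L h -> L (fun e => g e + c * h e).
Hypothesis YB : forall x y, Y x -> Y y -> L (fun e => y e - x e).
Hypothesis YD : forall x g, Y x -> L g -> (forall e, x e + g e <= 0) ->
  Y (fun e => x e + g e).
Hypothesis Yle0 : forall x e, Y x -> x e <= 0.
Hypothesis surj : forall x (t : coords R n), Y x ->
  exists2 g, L g & forall e, x e = 0 \/ H e -> g e = t e.

Lemma LZ c g : L g -> L (fun e => c * g e).
Proof. by move=> Lg; have := LD c L0 Lg; under eq_fun do rewrite add0r. Qed.

Lemma L_sum (I : Type) (r : seq I) (c : I -> R) (f : I -> coords R n) :
  (forall i, L (f i)) -> L (fun e => \sum_(i <- r) c i * f i e).
Proof.
move=> Lf; elim: r => [|i r IH].
  by under eq_fun do rewrite big_nil.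
by under eq_fun do rewrite big_cons addrC; apply: LD.
Qed.

Lemma linear_step (c x g : coords R n) t :
  \sum_e c e * (x e + t * g e) = \sum_e c e * x e + t * \sum_e c e * g e.
Proof. by rewrite mulr_sumr -big_split; apply: eq_bigr => e _ /=; ring. Qed.

Lemma step_in x g : Y x -> L g -> (forall e, x e = 0 -> g e <= 0) ->
  exists2 eps, 0 < eps & Y (fun e => x e + eps * g e).
Proof.
move=> Yx Lg tg.
have [|eps eps0 small] := @small_scale R _ [pred e | x e != 0] (fun e => - x e) g.
  by move=> e /= xe; rewrite oppr_gt0 lt_neqAle xe Yle0.
exists eps => //; apply: YD => // [|e]; first exact: LZ.
have [xe|xe] := eqVneq (x e) 0; last by have := small e xe; lra.
by rewrite xe add0r pmulr_rle0 // tg.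
Qed.

(** Such a direction can be followed a little both ways, so the functional can neither increase nor
    decrease along it. *)
Lemma flat_direction (c : coords R n) c0 x g :
  (forall y, Y y -> \sum_e c e * y e <= c0) -> Y x -> \sum_e c e * x e = c0 ->
  L g -> (forall e, x e = 0 -> g e = 0) -> \sum_e c e * g e = 0.
Proof.
move=> sup Yx cx Lg tg; apply/eqP; rewrite eq_le; apply/andP; split.
  have [|eps e0 /sup] := step_in Yx Lg; first by move=> e /tg ->.
  by rewrite linear_step cx gerDl pmulr_rle0.
have [|eps e0 /sup] := step_in Yx (LZ (-1) Lg); first by move=> e /tg ->; rewrite mulr0.
have -> : \sum_e c e * (x e + eps * (-1 * g e)) = \sum_e c e * (x e + (- eps) * g e).
  by apply: eq_bigr => e _; rewrite mulN1r mulrN mulNr.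
by rewrite linear_step cx gerDl mulNr oppr_le0 pmulr_rge0.
Qed.

(** The supporting functional adds up the coordinates in [S]; as none is positive, the sum is zero
    only when each is. *)
Lemma tight_face (S : pairs n -> Prop) :
  is_face Y (fun d => Y d /\ forall e, S e -> d e = 0).
Proof.
pose c e : R := `[< S e >]%:R.
have cle d e : Y d -> c e * d e <= 0.
  by move=> Yd; rewrite mulr_ge0_le0 ?ler0n ?Yle0.
exists c, 0; split=> [d Yd|]; first by apply: sumr_le0 => e _; apply: cle.
apply/funext => d; apply/propext; split=> -[Yd tight]; split=> //.
  by rewrite big1 // => e _; rewrite /c; case: asboolP => [/tight ->|_]; rewrite ?mulr0 ?mul0r.
move=> e Se; have s0 : \sum_e - (c e * d e) == 0 by rewrite sumrN tight oppr0.
have := s0; rewrite psumr_eq0; last by move=> i _; rewrite oppr_ge0 cle.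
move=> /allP/(_ e (mem_index_enum _)); rewrite oppr_eq0 /c.
by case: asboolP => // _; rewrite mul1r => /eqP.
Qed.

(** Lowering coordinate [e] with the tight ones fixed stays in [G] until another coordinate reaches
    zero, and boundedness forces this to happen. At that point one more coordinate is tight and
    [x e] is still negative: induction on the number of nonzero coordinates. *)
Lemma bounded_face_tight G x e : bounded_face Y G -> G x -> H e -> x e = 0.
Proof.
move=> [[c [c0 [sup GE]]] [M bM]] Gx He; apply/eqP/negPn/negP => xe.
have Yx : Y x by move: Gx; rewrite GE => -[].
have {xe} : x e < 0 by rewrite lt_neqAle xe Yle0.
have [k] := ubnP #|[pred e | x e != 0]|; elim: k x Gx Yx => // k IH x Gx Yx card xe.
have [g Lg gE] := surj (fun e' => - (e' == e)%:R) Yx.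
have ge : g e = -1 by rewrite gE ?eqxx //; right.
have gT e' : x e' = 0 -> g e' = 0.
  move=> xe'; rewrite gE; last by left.
  by case: eqP => [ee|_]; [move: xe; rewrite -ee xe' ltxx|rewrite oppr0].
have cx : \sum_e c e * x e = c0 by move: Gx; rewrite GE => -[].
have cg := flat_direction sup Yx cx Lg gT.
have ray t : (forall e, x e + t * g e <= 0) -> G (fun e => x e + t * g e).
  move=> le; rewrite GE; split; last by rewrite linear_step cx cg mulr0 addr0.
  by apply: YD => //; apply: LZ.
have [e1 e1P|none] := pickP (fun e => 0 < g e); last first.
  (* No coordinate increases, so the whole ray lies in [G]; at [M + 1] its coordinate [e] is below
     [- M]. *)
  have M0 : 0 <= M by apply: le_trans (bM _ Gx e); apply: normr_ge0.
  have := bM _ (ray (M + 1) _) e; rewrite ge ltr0_norm; last lra.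
  move=> b; have : - (x e + (M + 1) * -1) <= M; last lra.
  apply: b => e'; have := none e'; rewrite ltNge => /negbFE gle.
  have := Yle0 e' Yx; have : (M + 1) * g e' <= 0 by rewrite mulr_ge0_le0 //; lra.
  lra.
case: (@arg_minP _ _ _ e1 (fun e => 0 < g e) (fun e => - x e / g e) e1P) => e2 g2 min2.
set t := - x e2 / g e2 in min2.
have x2 : x e2 != 0 by apply: contraTneq g2 => /gT ->; rewrite ltxx.
have t0 : 0 < t by rewrite divr_gt0 // oppr_gt0 lt_neqAle x2 Yle0.
have le0 e' : x e' + t * g e' <= 0.
  have [gp|gn] := ltP 0 (g e').
    have : t <= - x e' / g e' := min2 _ gp.
    by rewrite ler_pdivlMr //; lra.
  have := Yle0 e' Yx; have : t * g e' <= 0 by rewrite pmulr_rle0.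
  lra.
have Gx' := ray t le0.
apply: (IH _ Gx').
- by move: Gx'; rewrite GE => -[].
- rewrite ltnS in card; apply: leq_trans card; apply: proper_card; apply/properP; split.
    apply/subsetP => e'; rewrite !inE; apply: contraNneq => x0.
    by rewrite x0 gT // mulr0 addr0.
  by exists e2; rewrite !inE //= negbK /t divfK ?subrr // gt_eqF.
- by rewrite ge; lra.
Qed.

Lemma affdim_unique (S : coords R n -> Prop) k k' : affdim S k -> affdim S k' -> k = k'.
Proof.
move=> [[z [Sz iz]] up] [[z' [Sz' iz']] up']; apply/eqP; rewrite eqn_leq.
by rewrite (up' _ _ Sz iz) (up _ _ Sz' iz').
Qed.

(** * The polyhedron near a vertex *)

Section Vertex.
Variable x : coords R n.
Hypothesis vx : is_vertex Y x.

Lemma vertex_in : Y x.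
Proof.
case: vx => c [c0 [_ /(congr1 (@^~ x)) /= E]].
by have : x = x by []; rewrite E => -[].
Qed.

(** Otherwise a small step along [g] would stay in the face whose only point is [x]. *)
Lemma vertex_inj g : L g -> (forall e, x e = 0 -> g e = 0) -> forall e, g e = 0.
Proof.
move=> Lg tg e; have Yx := vertex_in.
case: vx => c [c0 [sup E]].
have {}E y : (y = x) = (Y y /\ \sum_e c e * y e = c0) := congr1 (@^~ y) E.
have cx : \sum_e c e * x e = c0 by have : x = x by []; rewrite E => -[].
have [|eps e0 Ys] := step_in Yx Lg; first by move=> e' /tg ->.
have : (fun e => x e + eps * g e) = x.
  by rewrite E; split=> //; rewrite linear_step (flat_direction sup Yx cx Lg tg) mulr0 addr0.
move=> /(congr1 (@^~ e)) /eqP; rewrite -subr_eq0 addrAC subrr add0r mulf_eq0.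
by rewrite gt_eqF //= => /eqP.
Qed.

Definition tight : {set pairs n} := [set e | x e == 0].

(** A point on the edge at [x] that releases only the tight coordinate [e]. Such points span the
    faces at [x] and tell its facets apart. *)
Lemma tight_neighbour e : e \in tight ->
  exists y, [/\ Y y, y e < 0 & forall e', e' \in tight -> e' != e -> y e' = 0].
Proof.
move=> eT; have Yx := vertex_in.
have [g Lg gE] := surj (fun e' => - (e' == e)%:R) Yx.
have [|eps e0 Ys] := step_in Yx Lg.
  by move=> e' xe; rewrite gE; [rewrite oppr_le0 ler0n|left].
exists (fun e => x e + eps * g e); split=> //.
  by move: eT; rewrite inE => /eqP xe; rewrite gE ?eqxx; [rewrite xe /=; lra|left].
move=> e'; rewrite inE => /eqP xe ne.
by rewrite gE ?(negbTE ne); [rewrite xe oppr0 mulr0 addr0|left].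
Qed.

(** The lower bound comes from [x] and its neighbours along the coordinates outside [S]. For the
    upper bound, a combination with weights of sum zero is a direction in [L], and [vertex_inj]
    makes it vanish once its coordinates in [tight :\: S] do. *)
Lemma affdim_tight_face (S : {set pairs n}) : S \subset tight ->
  affdim (fun d => Y d /\ forall e, e \in S -> d e = 0) #|tight :\: S|.
Proof.
move=> sST; have Yx := vertex_in; split.
  have /choice[y yP] : forall j : 'I_#|tight :\: S|, exists y,
      [/\ Y y, y (enum_val j) < 0 &
          forall e', e' \in tight -> e' != enum_val j -> y e' = 0].
    move=> j; apply: tight_neighbour.
    by have := enum_valP j; rewrite inE => /andP[].
  exists (fun i => if unlift ord0 i is Some j then y j else x); split.
    move=> i; case: unliftP => [j _|_].
      have [Yy _ y0] := yP j; split=> // e eS; apply: y0; first exact: (subsetP sST).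
      by apply: contraTneq eS => ->; have := enum_valP j; rewrite inE => /andP[].
    by split=> // e /(subsetP sST); rewrite inE => /eqP.
  move=> c; rewrite big_ord_recl => c1 c2.
  have cl j : c (lift ord0 j) = 0.
    have := c2 (enum_val j); rewrite big_ord_recl unlift_none.
    have /setDP[eT _] := enum_valP j.
    have /eqP -> : x (enum_val j) == 0 by move: eT; rewrite inE.
    rewrite mulr0 add0r (bigD1 j) //= liftK big1 ?addr0 => [/eqP|i ij].
      by have [_ yn _] := yP j; rewrite mulf_eq0 (lt_eqF yn) orbF => /eqP.
    rewrite liftK; have [_ _ ->] := yP i; rewrite ?mulr0 //.
    by apply: contra_neq ij => /enum_val_inj.
  move=> i; case: (unliftP ord0 i) => [j ->|->] //.
  by move: c1; rewrite big1 ?addr0.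
move=> m z zS indep; rewrite leqNgt; apply/negP => lt.
(* One column for the sum of the weights and one per coordinate outside [S]; more points than
   columns give a nonzero relation [u]. *)
pose C : 'M[R]_(m.+1, 1 + #|tight :\: S|) :=
  row_mx (const_mx 1) (\matrix_(i, j) z i (enum_val j)).
have : kermx C != 0.
  by rewrite kermx_eq0 /row_free neq_ltn (leq_ltn_trans (rank_leq_col C)).
case/rowV0Pn => u /sub_kermxP; rewrite mul_mx_row -[0]hsubmxK => /eq_row_mx[u1 u2] /eqP; apply.
have s1 : \sum_i u 0 i = 0.
  have := congr1 (fun A : 'M_(1, 1) => A 0 0) u1; rewrite !mxE => e1.
  by rewrite -[RHS]e1; apply: eq_bigr => i _; rewrite mxE mulr1.
have Ls : L (fun e => \sum_i u 0 i * z i e).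
  have := @L_sum _ (index_enum _) (fun i => u 0 i) (fun i e => z i e - z ord0 e).
  move=> /(_ (fun i => YB (zS ord0).1 (zS i).1)).
  rewrite (_ : (fun e => _) = (fun e => \sum_i u 0 i * z i e)) //.
  apply/funext => e; under eq_bigr do rewrite mulrBr.
  by rewrite sumrB -mulr_suml s1 mul0r subr0.
apply/rowP => i; rewrite mxE; apply: (indep (fun i => u 0 i)) => // e.
apply: (vertex_inj Ls) => {}e xe.
have [eS|eS] := boolP (e \in S).
  by rewrite big1 // => j _; rewrite (zS j).2 ?mulr0.
have eTS : e \in tight :\: S by rewrite inE eS inE xe eqxx.
have := congr1 (fun A : 'M_(1, _) => A 0 (enum_rank_in eTS e)) u2; rewrite !mxE => e1.
by rewrite -[RHS]e1; apply: eq_bigr => j _; rewrite mxE enum_rankK_in.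
Qed.

Lemma affdim_Y : affdim Y #|tight|.
Proof.
have := affdim_tight_face (sub0set _); rewrite setD0.
congr affdim; apply/funext => d; apply/propext; split=> [[]|Yd] //.
by split=> // e; rewrite inE.
Qed.

Lemma facet_tight e : e \in tight -> is_facet Y (fun d => Y d /\ d e = 0).
Proof.
move=> eT; have -> : (fun d => Y d /\ d e = 0) =
    (fun d => Y d /\ forall e', e' \in [set e] -> d e' = 0).
  apply/funext => d; apply/propext; split=> -[Yd de]; split=> //.
    by move=> e' /set1P ->.
  by apply: de; rewrite inE.
split; first exact: (tight_face (fun e' => e' \in [set e])).
exists #|tight :\: [set e]|; split; last by apply: affdim_tight_face; rewrite sub1set.
by have := affdim_Y; rewrite (cardsD1 e) eT.
Qed.

(** In the tight coordinates the supporting functional is [c0] plus a combination with coefficients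
    [gam e >= 0], so its face is cut out by the coordinates with [gam e != 0]; codimension one
    leaves exactly one of them. *)
Lemma facet_at_vertex G : is_facet Y G -> G x ->
  exists2 e, e \in tight & G = (fun d => Y d /\ d e = 0).
Proof.
move=> [[c [c0 [sup GE]]] [k [dY dG]]] Gx; have Yx := vertex_in.
have cx : \sum_e c e * x e = c0 by move: Gx; rewrite GE => -[].
(* Directions dual to the tight coordinates. *)
have /choice[g gP] : forall e, exists g, L g /\
    forall e', e' \in tight -> g e' = (e' == e)%:R.
  move=> e; have [g Lg gE] := surj (fun e' => (e' == e)%:R) Yx.
  by exists g; split=> // e'; rewrite inE => /eqP xe; apply: gE; left.
pose gam e := \sum_e' c e' * g e e'.
have gam_ge0 e : e \in tight -> 0 <= gam e.
  move=> eT; have [Lg gE] := gP e.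
  have [|eps e0 /sup] := step_in Yx (LZ (-1) Lg).
    by move=> e' xe; rewrite gE ?inE ?xe //; rewrite mulN1r oppr_le0 ler0n.
  rewrite linear_step cx gerDl pmulr_rle0 //.
  under eq_bigr do rewrite mulN1r mulrN.
  by rewrite sumrN oppr_le0.
have cE y : Y y -> \sum_e c e * y e = c0 + \sum_(e in tight) gam e * y e.
  move=> Yy.
  have Ld : L (fun e' => (y e' - x e') + (-1) * \sum_(e <- enum tight) y e * g e e').
    by apply: LD; [apply: YB|apply: L_sum => e; case: (gP e)].
  have E e' : y e' = x e' + \sum_(e in tight) y e * g e e'.
    suff : y e' - x e' + (-1) * \sum_(e <- enum tight) y e * g e e' = 0.
      by rewrite big_enum /=; lra.
    apply: (vertex_inj Ld) => {}e' xe'.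
    have e'T : e' \in tight by rewrite inE xe'.
    rewrite xe' subr0 big_enum (bigD1 e') //= big1 => [|e /andP[_ ne]].
      by have [_ ->] := gP e'; rewrite // eqxx mulr1 addr0 mulN1r subrr.
    by have [_ ->] := gP e; rewrite // eq_sym (negbTE ne) mulr0.
  under eq_bigr do rewrite E mulrDr mulr_sumr.
  rewrite big_split /= cx exchange_big /=; congr (_ + _); apply: eq_bigr => e _.
  by rewrite /gam mulr_suml; apply: eq_bigr => e' _; ring.
pose S := [set e in tight | gam e != 0].
have ST : S \subset tight by apply/subsetP => e; rewrite inE => /andP[].
have GS : G = (fun d => Y d /\ forall e, e \in S -> d e = 0).
  rewrite GE; apply/funext => d; apply/propext; split=> -[Yd]; split=> //.
    move=> e; rewrite inE => /andP[eT ge].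
    move: b; rewrite cE // => /eqP; rewrite -subr_eq0 addrAC subrr add0r.
    rewrite -oppr_eq0 -sumrN psumr_eq0 => [|e' e'T]; last first.
      by rewrite oppr_ge0 mulr_ge0_le0 ?Yle0 ?gam_ge0.
    move=> /allP/(_ e (mem_index_enum _)); rewrite eT oppr_eq0 mulf_eq0 (negbTE ge).
    by move=> /eqP.
  rewrite cE // big1 ?addr0 // => e eT; have [->|ge] := eqVneq (gam e) 0; first by rewrite mul0r.
  by rewrite b ?mulr0 // inE eT.
have k1 : k.+1 = #|tight| by apply: affdim_unique dY affdim_Y.
have k2 : k = #|tight :\: S|.
  by apply: affdim_unique dG _; rewrite GS; apply: affdim_tight_face.
have : #|S| == 1%N.
  by have := cardsID S tight; rewrite (setIidPr ST) -k1 -k2 -addn1 addnC => /addnI ->.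
case/cards1P => e Se; exists e; first by apply: (subsetP ST); rewrite Se inE.
rewrite GS Se; apply/funext => d; apply/propext; split=> -[Yd de]; split=> //.
  by apply: de; rewrite inE.
by move=> e' /set1P ->.
Qed.

End Vertex.

Lemma simple_of_surjective : is_polyhedron Y -> simple_polyhedron Y.
Proof.
move=> pY; split=> // k dY x vx.
have kE : k = #|tight x| by apply: affdim_unique dY (affdim_Y vx).
subst k; exists (fun i d => Y d /\ d (enum_val i) = 0); split; last split.
- move=> i j /(congr1 (fun F => forall d, F d -> d (enum_val i) = 0)) E.
  apply/eqP/negPn/negP => ij.
  have [y [Yy yn y0]] := tight_neighbour vx (enum_valP i).
  suff : y (enum_val i) = 0 by move=> y1; rewrite y1 ltxx in yn.
  have : forall d, Y d /\ d (enum_val j) = 0 -> d (enum_val i) = 0.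
    by rewrite -E => d [].
  apply; split=> //; apply: y0; first exact: enum_valP.
  by apply: contra_neq ij => /enum_val_inj.
- move=> i; split; first exact: (facet_tight vx (enum_valP i)).
  split; first exact: vertex_in.
  by have := enum_valP i; rewrite inE => /eqP.
- move=> G fG Gx; have [e eT ->] := facet_at_vertex vx fG Gx.
  by exists (enum_rank_in eT e); rewrite enum_rankK_in.
Qed.

End Polyhedron.

(** * The four-point relations *)

Section Pairs.
Variables (R : realType) (n : nat).
Implicit Types (d : coords R n) (e : pairs n) (i j : 'I_n).

Lemma pair_lt e : (pfst e < psnd e)%N.
Proof. exact: (valP e). Qed.

Lemma pair_neq e : pfst e != psnd e.
Proof. by rewrite neq_ltn pair_lt. Qed.

Lemma dd_pair d e : dd d (pfst e) (psnd e) = d e.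
Proof. by rewrite /dd -surjective_pairing valK. Qed.

Lemma dd_sym d i j : dd d i j = dd d j i.
Proof.
wlog lt : i j / (i <= j)%N; first by case/orP: (leq_total i j) => /[swap] /[apply].
by rewrite /dd [insub (j, i)]insubF /= ?ltnNge ?lt //; case: insub.
Qed.

Lemma dd_diag d i : dd d i i = 0.
Proof. by rewrite /dd insubF //= ltnn. Qed.

Lemma pair_spanning i j : i != j ->
  exists e, (i = pfst e /\ j = psnd e) \/ (j = pfst e /\ i = psnd e).
Proof.
rewrite neq_ltn => /orP[lt|lt].
  by exists (Sub (i, j) lt); left; rewrite /pfst /psnd SubK.
by exists (Sub (j, i) lt); right; rewrite /pfst /psnd SubK.
Qed.

Lemma dd_coord i j : i != j -> exists e, forall d, dd d i j = d e.
Proof.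
move=> /pair_spanning[e [[-> ->]|[-> ->]]]; exists e => d; first exact: dd_pair.
by rewrite dd_sym dd_pair.
Qed.

Lemma dd_sym_fun (g : 'I_n -> 'I_n -> R) i j : (forall i j, g i j = g j i) ->
  i != j -> dd (fun e => g (pfst e) (psnd e)) i j = g i j.
Proof.
move=> gs /pair_spanning[e [[-> ->]|[-> ->]]]; first by rewrite dd_pair.
by rewrite dd_sym dd_pair gs.
Qed.

Lemma ddD c d d' i j : dd (fun e => d e + c * d' e) i j = dd d i j + c * dd d' i j.
Proof.
have [->|ne] := eqVneq i j; first by rewrite !dd_diag mulr0 addr0.
by have [e E] := dd_coord ne; rewrite !E.
Qed.

Lemma dd_sum d i j : dd d i j = \sum_e dd (fun e' => (e' == e)%:R) i j * d e.
Proof.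
have [->|ne] := eqVneq i j.
  by rewrite dd_diag big1 // => e _; rewrite dd_diag mul0r.
have [e E] := dd_coord ne; rewrite E (bigD1 e) //= E eqxx mul1r big1 ?addr0 // => e' ne'.
by rewrite E eq_sym (negbTE ne') mul0r.
Qed.

End Pairs.

Section FourPoints.
Variables (R : realType) (n : nat) (p : 'I_n -> pt R).
Hypothesis gp : general_position p.
Local Notation det i j k := (det3 (p i) (p j) (p k)).

(** The weights are the self-stress of the complete graph on four points, unique up to scale, so
    stretches have value zero; the scale is the one that gives [fab] the value one. *)
Definition four (g : 'I_n -> 'I_n -> R) i j k l :=
  wgt p i j k l * g i j + wgt p i k j l * g i k +
  wgt p i l j k * g i l + wgt p j k i l * g j k +
  wgt p j l i k * g j l + wgt p k l i j * g k l.

Lemma fourE g i j k l : uniq [:: i; j; k; l] ->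
  four g i j k l * (det i j k * det i j l * det i k l * det j k l) =
  det i k l * det j k l * g i j - det i j l * det j k l * g i k
  + det i j k * det j k l * g i l + det i j l * det i k l * g j k
  - det i j k * det i k l * g j l + det i j k * det i j l * g k l.
Proof.
rewrite /= !inE !negb_or => /and4P[/and3P[ij ik il] /andP[jk jl] kl _].
have A0 : det i j k != 0 by apply: gp.
have B0 : det i j l != 0 by apply: gp.
have C0 : det i k l != 0 by apply: gp.
have E0 : det j k l != 0 by apply: gp.
rewrite /four /wgt.
have cyc a b c : det a b c = det b c a by rewrite !det3E; ring.
have anti a b c : det a b c = - det a c b by rewrite !det3E; ring.
rewrite (anti i k j) (anti i l j) (anti i l k) -(cyc i j k) (anti j l i) (anti j i l).
rewrite -(cyc i j l) (anti j l k) -(cyc i k l) -(cyc j k l).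
move: A0 B0 C0 E0; move: (det i j k) (det i j l) (det i k l) (det j k l) => A B C E A0 B0 C0 E0.
by field; rewrite A0 B0 C0 E0.
Qed.

Lemma four_eq0 g i j k l : uniq [:: i; j; k; l] ->
  det i k l * det j k l * g i j - det i j l * det j k l * g i k
  + det i j k * det j k l * g i l + det i j l * det i k l * g j k
  - det i j k * det i k l * g j l + det i j k * det i j l * g k l = 0 ->
  four g i j k l = 0.
Proof.
move=> u; rewrite -fourE // => /eqP; rewrite !mulf_eq0 => /orP[/eqP //|].
move: u; rewrite /= !inE !negb_or => /and4P[/and3P[ij ik il] /andP[jk jl] kl _].
by rewrite !(negbTE (gp _ _ _)).
Qed.

Lemma four_stretch v i j k l : uniq [:: i; j; k; l] -> four (stretch p v) i j k l = 0.
Proof.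
by move=> /four_eq0; apply; rewrite !det3E /stretch /dot /psub /=; ring.
Qed.

Lemma four_fab a b i j k l : uniq [:: i; j; k; l] -> four (fab a b p) i j k l = 1.
Proof.
move=> u; apply/eqP; rewrite -subr_eq0.
have := u; rewrite /= !inE !negb_or => /and4P[/and3P[ij ik il] /andP[jk jl] kl _].
have n0 : det i j k * det i j l * det i k l * det j k l != 0.
  by rewrite !mulf_neq0 //; apply: gp.
rewrite -(inj_eq (mulIf n0)) mulrBl mul0r mul1r fourE // subr_eq0; apply/eqP.
by rewrite /fab !det3E; ring.
Qed.
End FourPoints.

Section Stretch.
Variables (R : realType) (n : nat) (p : 'I_n -> pt R).

Definition stretches (v : motion R n) : coords R n :=
  fun e => stretch p v (pfst e) (psnd e).

Lemma stretch_sym v i j : stretch p v i j = stretch p v j i.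
Proof. by rewrite /stretch /dot /psub /=; ring. Qed.

Lemma fab_sym a b i j : fab a b p i j = fab a b p j i.
Proof. by rewrite /fab !det3E; ring. Qed.

Lemma stretchD c v v' i j :
  stretch p (fun i => ((v i).1 + c * (v' i).1, (v i).2 + c * (v' i).2)) i j =
  stretch p v i j + c * stretch p v' i j.
Proof. by rewrite /stretch /dot /psub /=; ring. Qed.

Lemma stretch_sum (I : finType) (k : I -> R) (v : I -> motion R n) i j :
  stretch p (fun i => (\sum_c k c * (v c i).1, \sum_c k c * (v c i).2)) i j =
  \sum_c k c * stretch p (v c) i j.
Proof.
rewrite /stretch /dot /psub /= -!sumrB !mulr_sumr -big_split.
by apply: eq_bigr => c _ /=; ring.
Qed.

Lemma sum_pairs (f : 'I_n -> 'I_n -> R) :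
  \sum_(e : pairs n) f (pfst e) (psnd e) = \sum_(i < n) \sum_(j < n | (i < j)%N) f i j.
Proof.
rewrite pair_big_dep /=.
rewrite [RHS](reindex_omap (fun e : pairs n => val e) insub) /=.
  by apply: eq_bigl => e; rewrite valK eqxx (valP e).
by move=> e Pe; rewrite insubT.
Qed.

Lemma virtual_work (w : 'I_n -> 'I_n -> R) v : (forall i j, w i j = w j i) ->
  \sum_(e : pairs n) w (pfst e) (psnd e) * stretches v e =
  \sum_i \sum_j w i j * dot (psub (p i) (p j)) (v i).
Proof.
move=> ws; rewrite (sum_pairs (fun i j => w i j * stretch p v i j)).
transitivity (\sum_(i < n) \sum_(j < n | (i < j)%N) w i j * dot (psub (p i) (p j)) (v i) +
   \sum_(i < n) \sum_(j < n | (i < j)%N) w j i * dot (psub (p j) (p i)) (v j)).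
  rewrite -big_split; apply: eq_bigr => i _; rewrite -big_split; apply: eq_bigr => j _ /=.
  by rewrite (ws j i) /stretch /dot /psub /=; ring.
rewrite [X in _ + X](exchange_big_dep predT) //= -big_split; apply: eq_bigr => i _ /=.
rewrite [RHS](bigD1 i) //=.
have -> : w i i * dot (psub (p i) (p i)) (v i) = 0 by rewrite /dot /psub /=; ring.
rewrite add0r.
rewrite [RHS](bigID (fun j : 'I_n => (i < j)%N)) /=; congr (_ + _); apply: eq_bigl => j.
  by case: (ltngtP i j) => [lt|lt|/val_inj ->]; rewrite ?andbF ?andbT ?eqxx // -?val_eqE ?gt_eqF.
by case: (ltngtP i j) => [lt|lt|/val_inj ->]; rewrite ?andbF ?andbT ?eqxx // -?val_eqE ?lt_eqF.
Qed.
End Stretch.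

(** Independent rows have a right inverse. The rows are indexed by [T], and a relation between them,
    extended by zero, is a [w] as in the hypothesis. *)
Lemma surjective_of_independent (R : realType) (E C : finType) (T : {set E})
    (F : C -> E -> R) :
  (forall w : E -> R, (forall e, e \notin T -> w e = 0) ->
     (forall c, \sum_e w e * F c e = 0) -> forall e, w e = 0) ->
  forall t : E -> R, exists k : C -> R, forall e, e \in T -> \sum_c k c * F c e = t e.
Proof.
move=> indep t.
pose M : 'M[R]_(#|T|, #|C|) := \matrix_(a, b) F (enum_val b) (enum_val a).
have : row_free M.
  rewrite -kermx_eq0; apply/rowV0P => u /sub_kermxP uM.
  pose w e := \sum_(a | enum_val a == e) u 0 a.
  have wE a : w (enum_val a) = u 0 a.
    rewrite /w (bigD1 a) //= big1 ?addr0 // => b /andP[/eqP/enum_val_inj ->].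
    by rewrite eqxx.
  apply/rowP => a; rewrite mxE -wE; apply: indep => [e eT|c].
    by rewrite /w big1 // => b /eqP be; rewrite -be enum_valP in eT.
  have := congr1 (fun A : 'rV_ _ => A 0 (enum_rank c)) uM; rewrite !mxE => uMc.
  rewrite -[RHS]uMc (bigID (mem T)) /= [X in _ + X]big1 ?addr0; last first.
    by move=> e eT; rewrite /w big1 ?mul0r // => b /eqP be; rewrite -be enum_valP in eT.
  rewrite big_enum_val; apply: eq_bigr => b _.
  by rewrite wE !mxE enum_rankK.
case/row_freeP => N MN.
pose r : 'cV_ _ := N *m (\col_a t (enum_val a)).
exists (fun c => r (enum_rank c) 0) => e eT.
have := congr1 (fun A : 'cV_ _ => A (enum_rank_in eT e) 0) (mulmxA M N (\col_a t (enum_val a))).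
rewrite MN mul1mx !mxE enum_rankK_in // => <-.
rewrite (reindex (@enum_val C predT)) /=; last exact: onW_bij (enum_val_bij _).
apply: eq_bigr => b _; rewrite !mxE enum_valK mulrC enum_rankK_in //.
Qed.

Lemma hull_edge_sym (R : realType) n (p : 'I_n -> pt R) i j :
  hull_edge p i j -> hull_edge p j i.
Proof.
have anti k : det3 (p j) (p i) (p k) = - det3 (p i) (p j) (p k) by rewrite !det3E; ring.
move=> [ne side]; split; first by rewrite eq_sym.
by case: side => side; [right|left] => k ki kj; rewrite anti ?oppr_lt0 ?oppr_gt0 side.
Qed.

(** * Tight pairs and hull edges *)

Section TautGraph.
Variables (R : realType) (n : nat) (p : 'I_n -> pt R).
Hypothesis gp : general_position p.
Hypothesis pinj : injective p.
Local Notation det i j k := (det3 (p i) (p j) (p k)).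
Variable d : coords R n.
Hypothesis Yd : Yset p d.

Definition taut i j := i != j /\ (dd d i j = 0 \/ hull_edge p i j).

Lemma dd_le0 i j : dd d i j <= 0.
Proof.
have [->|ne] := eqVneq i j; first by rewrite dd_diag.
by have [e ->] := dd_coord R ne; apply: Yd.2.
Qed.

Lemma hull_edge_side i j k l : hull_edge p i j -> k != i -> k != j -> l != i -> l != j ->
  0 < det i j k * det i j l.
Proof.
move=> [_ [side|side]] ki kj li lj; first by rewrite mulr_gt0 ?side.
by rewrite nmulr_rgt0 side.
Qed.

Lemma det_relation i j k l : det i j k - det i j l + det i k l - det j k l = 0.
Proof. by rewrite !det3E; ring. Qed.

Lemma mulr_lt0P (x y : R) : x * y < 0 -> (0 < x /\ y < 0) \/ (x < 0 /\ 0 < y).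
Proof.
have [xp|xn|<-] := ltgtP 0 x; last by rewrite mul0r ltxx.
  by rewrite pmulr_rlt0 //; left.
by rewrite nmulr_rlt0 //; right.
Qed.

Lemma taut_noncrossing i j k l : uniq [:: i; j; k; l] -> taut i j -> taut k l ->
  det i j k * det i j l < 0 -> det k l i * det k l j < 0 -> False.
Proof.
move=> u [_ tij] [_ tkl] c1 c2.
have /and4P[] := u; rewrite !inE !negb_or => /and3P[ij ik il] /andP[jk jl] kl _.
(* A hull edge has the other points on one side and crosses nothing, so both pairs are tight. *)
have [hij|nij] := pselect (hull_edge p i j).
  have := @hull_edge_side i j k l hij; rewrite ![_ == i]eq_sym ![_ == j]eq_sym => /(_ ik jk il jl).
  lra.
have [hkl|nkl] := pselect (hull_edge p k l).
  have := @hull_edge_side k l i j hkl ik il jk jl; lra.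
case: tij => [dij|//]; case: tkl => [dkl|//].
have := fourE gp (dd d) u; have -> : four p (dd d) i j k l = 1 := Yd.1 _ _ _ _ u.
rewrite dij dkl !mulr0 mul1r.
have r := det_relation i j k l.
have cyc a b c : det a b c = det b c a by rewrite !det3E; ring.
rewrite -[det k l i]cyc -[det k l j]cyc in c2.
have := dd_le0 i k; have := dd_le0 i l; have := dd_le0 j k; have := dd_le0 j l.
move: (dd d i k) (dd d i l) (dd d j k) (dd d j l) => x y z t t0 z0 y0 x0.
move: (det i j k) (det i j l) (det i k l) (det j k l) c1 c2 r => A B C E c1 c2 r eq.
have pos : 0 < A * B * (C * E) by rewrite nmulr_rgt0.
suff neg : 0 <= B * E * x /\ A * E * y <= 0 /\ B * C * z <= 0 /\ 0 <= A * C * t by lra.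
case: (mulr_lt0P c1) => -[a0 b0]; case: (mulr_lt0P c2) => -[e0 f0]; try lra.
  have := nmulr_rlt0 E b0; have := pmulr_rgt0 E a0; have := nmulr_rgt0 C b0.
  have := pmulr_rlt0 C a0; rewrite e0 f0 => q1 q2 q3 q4.
  by rewrite nmulr_rge0 // pmulr_rle0 // pmulr_rle0 // nmulr_rge0.
have := pmulr_rlt0 E b0; have := nmulr_rgt0 E a0; have := pmulr_rgt0 C b0.
have := nmulr_rlt0 C a0; rewrite e0 f0 => q1 q2 q3 q4.
by rewrite nmulr_rge0 // pmulr_rle0 // pmulr_rle0 // nmulr_rge0.
Qed.

Lemma det_gt0_neq i j k : 0 < det i j k -> j != k.
Proof.
apply: contraTneq => ->; suff -> : det i k k = 0 by rewrite ltxx.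
by rewrite det3E; ring.
Qed.

Lemma taut_pointed i j k l : taut i j -> taut i k -> taut i l ->
  0 < det i j k -> 0 < det i k l -> 0 < det i l j -> False.
Proof.
move=> [ij tij] [ik tik] [il til] d1 d2 d3.
have jk := det_gt0_neq d1; have kl := det_gt0_neq d2; have lj := det_gt0_neq d3.
have anti a b c : det a b c = - det a c b by rewrite !det3E; ring.
have u : uniq [:: i; j; k; l] by rewrite /= !inE !negb_or ij ik il jk kl eq_sym lj.
have nohull b c e : i != c -> i != e -> b != c -> e != b ->
    0 < det i b c -> 0 < det i e b -> ~ hull_edge p i b.
  move=> ic ie bc eb p1; rewrite anti => p2 /(@hull_edge_side i b c e).
  rewrite eq_sym ic eq_sym bc eq_sym ie eb => /(_ isT isT isT isT).
  rewrite pmulr_rgt0 //; lra.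
case: tij => [dij|/(nohull j k l ik il jk lj d1 d3) //].
case: tik => [dik|/(nohull k l j il ij kl jk d2 d1) //].
case: til => [dil|/(nohull l j k ij ik lj kl d3 d2) //].
have := fourE gp (dd d) u; have -> : four p (dd d) i j k l = 1 := Yd.1 _ _ _ _ u.
rewrite dij dik dil !mulr0 mul1r.
have r := det_relation i j k l.
have := dd_le0 j k; have := dd_le0 j l; have := dd_le0 k l.
rewrite anti in d3.
move: (dd d j k) (dd d j l) (dd d k l) => x y z z0 y0 x0.
move: (det i j k) (det i j l) (det i k l) (det j k l) d1 d2 d3 r => A B C E d1 d2 d3 r eq.
(* The area of the outer triangle is the sum of the three inner ones. *)
have E0 : 0 < E by lra.
have B0 : B < 0 by lra.
have h1 : A * B < 0 by rewrite pmulr_rlt0.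
have h2 : A * B * C * E < 0 by rewrite pmulr_llt0 // pmulr_llt0.
have h3 : 0 <= B * C * x by rewrite nmulr_rge0 // nmulr_rlt0.
have h4 : A * C * y <= 0 by rewrite pmulr_rle0 // mulr_gt0.
have h5 : 0 <= A * B * z by rewrite nmulr_rge0.
lra.
Qed.

(** By duality only independence is needed: a relation between the rows, tested on the motions [b]
    of one point along one axis, is a self-stress supported on taut pairs. *)
Lemma taut_surjective (t : coords R n) :
  exists v, forall e, d e = 0 \/ hull_edge p (pfst e) (psnd e) -> stretches p v e = t e.
Proof.
pose T := [set e | `[< d e = 0 \/ hull_edge p (pfst e) (psnd e) >]].
pose b (c : 'I_n * bool) : motion R n :=
  fun i => if c.2 then ((i == c.1)%:R, 0) else (0, (i == c.1)%:R).
have [|k kE] := @surjective_of_independent R _ _ T (fun c => stretches p (b c)) _ t; last first.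
  exists (fun i => (\sum_c k c * (b c i).1, \sum_c k c * (b c i).2)) => e te.
  by rewrite /stretches stretch_sum; apply: kE; rewrite inE; apply/asboolP.
move=> w wT bal e.
have tautw i j : dd w i j != 0 -> taut i j.
  have [->|ne] := eqVneq i j; first by rewrite dd_diag eqxx.
  move=> wij; split => //.
  have [e' [[ie je]|[je ie]]] := pair_spanning ne; move: wij; rewrite ie je;
    [rewrite dd_pair|rewrite dd_sym dd_pair] => we;
    have /asboolP : `[< d e' = 0 \/ hull_edge p (pfst e') (psnd e') >] by
      (apply/negPn/negP => h; case/eqP: we; apply: wT; rewrite inE).
  - by rewrite dd_pair.
  - by rewrite dd_sym dd_pair => -[|/hull_edge_sym]; [left|right].
rewrite -(dd_pair w); apply: (@stress_free _ _ p (dd w)) => //.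
- by move=> i j; apply: dd_sym.
- have bal' i (s : bool) : \sum_j dd w i j * (if s then (p j).1 - (p i).1 else (p j).2 - (p i).2) = 0.
    have := bal (i, s); under eq_bigr do rewrite -(dd_pair w).
    rewrite (virtual_work p (b (i, s)) (dd_sym w)) => e0.
    apply: oppr_inj; rewrite oppr0 -[RHS]e0 [RHS](bigD1 i) //= [X in _ = _ + X]big1 ?addr0; last first.
      move=> i' ne; rewrite big1 // => j _.
      by rewrite /b /dot /psub /= (negbTE ne); case: (s); rewrite !mulr0 addr0 mulr0.
    rewrite -sumrN; apply: eq_bigr => j _.
    by rewrite /b /dot /psub /= eqxx; case: (s) => /=; ring.
  move=> i a.
  transitivity (((p i).1 - a.1) * (\sum_j dd w i j * ((p j).2 - (p i).2)) -
                ((p i).2 - a.2) * (\sum_j dd w i j * ((p j).1 - (p i).1))).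
    rewrite !mulr_sumr -sumrB; apply: eq_bigr => j _.
    by rewrite det3E; ring.
  by rewrite (bal' i true) (bal' i false) !mulr0 subrr.
- by move=> i j k' l u /tautw t1 /tautw t2; apply: taut_noncrossing.
- by move=> i j k' l /tautw t1 /tautw t2 /tautw t3; apply: taut_pointed.
- exact: pair_neq.
Qed.

End TautGraph.

(** * Hull edges and wheels *)

Section Hull.
Variables (R : realType) (n : nat) (p : 'I_n -> pt R).
Hypothesis gp : general_position p.
Hypothesis pinj : injective p.
Local Notation det i j k := (det3 (p i) (p j) (p k)).

(* [i -> j] is a hull edge traversed counterclockwise. *)
Definition arrow i j :=
  (i != j) && [forall k, (k != i) && (k != j) ==> (0 < det i j k)].

Lemma arrowP i j : reflect
  (i != j /\ forall k, k != i -> k != j -> 0 < det i j k) (arrow i j).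
Proof.
apply: (iffP andP) => -[ij side]; split=> //.
  by move=> k ki kj; have /forallP/(_ k) := side; rewrite ki kj.
by apply/forallP => k; apply/implyP => /andP[]; apply: side.
Qed.

Lemma det_rot i j k : det i j k = det j k i.
Proof. by rewrite !det3E; ring. Qed.

Lemma arrow_hull i j : arrow i j -> hull_edge p i j.
Proof. by case/arrowP => ij side; split=> //; left. Qed.

Lemma arrow_out_uniq i j k : arrow i j -> arrow i k -> j = k.
Proof.
move=> /arrowP[ij sj] /arrowP[ik sk]; apply/eqP/negPn/negP => jk.
have := sj k; rewrite ![k == _]eq_sym => /(_ ik jk).
have := sk j; rewrite ![j == _]eq_sym [k == j]eq_sym => /(_ ij jk).
have -> : det i k j = - det i j k by rewrite !det3E; ring.
lra.
Qed.

Lemma arrow_in_uniq i j k : arrow j i -> arrow k i -> j = k.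
Proof.
move=> /arrowP[ji sj] /arrowP[ki sk]; apply/eqP/negPn/negP => jk.
have := sj k; rewrite [k == j]eq_sym => /(_ jk ki).
have := sk j jk ji; have -> : det j i k = - det k i j by rewrite !det3E; ring.
lra.
Qed.

Definition extreme i := exists al be, forall m, m != i ->
  0 < al * ((p m).1 - (p i).1) + be * ((p m).2 - (p i).2).

(** Seen from [p i] the other points lie in an open half-plane with inner normal [(al, be)], and
    [v / u] is the tangent of their angle to this normal. The extreme angles give the hull
    neighbours. *)
Lemma extreme_arrows i m : extreme i -> m != i -> (exists j, arrow i j) /\ exists k, arrow k i.
Proof.
move=> [al [be pos]] mi.
pose u k := al * ((p k).1 - (p i).1) + be * ((p k).2 - (p i).2).
pose v k := al * ((p k).2 - (p i).2) - be * ((p k).1 - (p i).1).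
have N0 : 0 < al ^+ 2 + be ^+ 2.
  have a2 := sqr_ge0 al; have b2 := sqr_ge0 be.
  rewrite lt_neqAle addr_ge0 // andbT eq_sym paddr_eq0 // !sqrf_eq0.
  apply/negP => /andP[/eqP a0 /eqP b0].
  by have := pos m mi; rewrite a0 b0 !mul0r addr0 ltxx.
have key j k : j != i -> k != i -> k != j -> v j / u j <= v k / u k -> 0 < det i j k.
  move=> ji ki kj; rewrite ler_pdivrMr ?pos // mulrAC ler_pdivlMr ?pos // -subr_ge0.
  have -> : v k * u j - v j * u k = (al ^+ 2 + be ^+ 2) * det i j k.
    by rewrite det3E /u /v; ring.
  rewrite pmulr_rge0 // lt_neqAle => ->; rewrite andbT eq_sym; apply: gp; by rewrite // eq_sym.
case: (@arg_minP _ _ _ m (fun j => j != i) (fun j => v j / u j) mi) => j ji jmin.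
case: (@arg_maxP _ _ _ m (fun j => j != i) (fun j => v j / u j) mi) => k ki kmax.
split; [exists j|exists k]; apply/arrowP; split=> //; first by rewrite eq_sym.
  by move=> l li lj; apply: key => //; apply: jmin.
by move=> l lk li; rewrite det_rot; apply: key => //; [rewrite eq_sym|apply: kmax].
Qed.

(** The normal functional of the edge vanishes at [j]; a slight tilt towards [j] makes it positive
    there and keeps it positive at the finitely many other points. *)
Lemma hull_extreme i j : hull_edge p i j -> extreme i.
Proof.
case=> ij side.
have [s [s1 sdet]] : exists s : R, s ^+ 2 = 1 /\
    forall k, k != i -> k != j -> 0 < s * det i j k.
  case: side => side; [exists 1|exists (-1)]; split=> [|k ki kj]; rewrite ?expr1n ?sqrrN ?expr1n //.
    by rewrite mul1r side.
  by rewrite mulN1r oppr_gt0 side.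
pose q : pt R := ((p j).1 - (p i).1, (p j).2 - (p i).2).
pose g k := q.1 * ((p k).1 - (p i).1) + q.2 * ((p k).2 - (p i).2).
have [|eps e0 small] := @small_scale R _ [pred k | (k != i) && (k != j)]
  (fun k => s * det i j k) (fun k => - g k).
  by move=> k /andP[]; apply: sdet.
exists (eps * q.1 - s * q.2), (eps * q.2 + s * q.1) => m mi.
have -> : (eps * q.1 - s * q.2) * ((p m).1 - (p i).1) +
    (eps * q.2 + s * q.1) * ((p m).2 - (p i).2) = s * det i j m + eps * g m.
  by rewrite det3E /g /q /=; ring.
have [->|mj] := eqVneq m j; last first.
  by have := small m; rewrite /= mi mj => /(_ isT); lra.
have -> : s * det i j j + eps * g j = eps * (q.1 ^+ 2 + q.2 ^+ 2).
  by rewrite det3E /g /q /=; ring.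
rewrite mulr_gt0 // lt_neqAle addr_ge0 ?sqr_ge0 // andbT eq_sym paddr_eq0 ?sqr_ge0 //.
rewrite !sqrf_eq0 !subr_eq0; apply: contra ij => /andP[/eqP x1 /eqP x2].
by apply/eqP/pinj; rewrite [RHS]surjective_pairing x1 x2 -surjective_pairing.
Qed.

Lemma hull_nonempty i0 j0 : i0 != j0 :> 'I_n -> exists i j, arrow i j.
Proof.
move=> ne; have [t tinj] := shear_distinct pinj.
case: (@arg_minP _ _ _ i0 predT (fun i => (shear t (p i)).1) isT) => i _ imin.
have ext : extreme i.
  exists 1, t => m mi.
  have : (shear t (p i)).1 < (shear t (p m)).1.
    rewrite lt_neqAle; apply/andP; split; last exact: imin.
    by apply: contra mi => /eqP /tinj ->.
  by rewrite /shear /=; lra.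
have [m mi] : exists m, m != i.
  by have [i0i|?] := eqVneq i0 i; [exists j0; rewrite -i0i eq_sym|exists i0].
by have [[j ij] _] := extreme_arrows ext mi; exists i, j.
Qed.

Definition on_hull i := [exists j, arrow i j].

Lemma arrow_from i j : arrow i j -> on_hull i.
Proof. by move=> a; apply/existsP; exists j. Qed.

Lemma arrow_to i j : arrow j i -> on_hull i.
Proof.
move=> a; have ne : j != i by case/arrowP: a.
by have [/existsP] := extreme_arrows (hull_extreme (hull_edge_sym (arrow_hull a))) ne.
Qed.

(** The default off the hull is a placeholder: on hull points [hull_next] and [hull_prev] are
    inverse permutations. *)
Definition hull_next i := odflt i [pick j | arrow i j].
Definition hull_prev i := odflt i [pick j | arrow j i].

Lemma arrow_next i : on_hull i -> arrow i (hull_next i).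
Proof. by case/existsP => j a; rewrite /hull_next; case: pickP => //= /(_ j); rewrite a. Qed.

Lemma arrow_prev i : on_hull i -> arrow (hull_prev i) i.
Proof.
case/existsP => j a; rewrite /hull_prev; case: pickP => //= none.
have ne : j != i by case/arrowP: a => + _; rewrite eq_sym.
have [_ [k ki]] := extreme_arrows (hull_extreme (arrow_hull a)) ne.
by have := none k; rewrite ki.
Qed.

Lemma prev_next i : on_hull i -> hull_prev (hull_next i) = i.
Proof.
move=> hi; have a := arrow_next hi.
by apply: arrow_in_uniq (arrow_prev (arrow_to a)) a.
Qed.

Lemma next_prev i : on_hull i -> hull_next (hull_prev i) = i.
Proof.
move=> hi; have a := arrow_prev hi.
by apply: arrow_out_uniq (arrow_next (arrow_from a)) a.
Qed.

(* The wheel with hub [o] carries a self-stress, positive [(rim i)^-1] on the hull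
   edges and negative [- spoke i] on the spokes. *)
Section Wheel.
Variable o : pt R.
Definition rim i := det3 o (p i) (p (hull_next i)).
Hypothesis rim_gt0 : forall i, on_hull i -> 0 < rim i.

Definition spoke i := det (hull_prev i) i (hull_next i) / (rim (hull_prev i) * rim i).

Lemma rim_prev i : on_hull i -> rim (hull_prev i) = det3 o (p (hull_prev i)) (p i).
Proof. by move=> hi; rewrite /rim next_prev. Qed.

Lemma rim_prev_gt0 i : on_hull i -> 0 < rim (hull_prev i).
Proof. by move=> hi; apply: rim_gt0; apply: arrow_from (arrow_prev hi). Qed.

Lemma spoke_gt0 i : on_hull i -> 0 < spoke i.
Proof.
move=> hi; have r1 := rim_gt0 hi; have r2 := rim_prev_gt0 hi.
rewrite /spoke divr_gt0 ?mulr_gt0 //.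
have /arrowP[pi side] := arrow_prev hi; apply: side.
  (* If both neighbours coincide, [rim] measures one segment in both directions and cannot be
     positive twice. *)
  apply/eqP => e; move: r1 r2; rewrite rim_prev // /rim e.
  have -> : det3 o (p (hull_prev i)) (p i) = - det3 o (p i) (p (hull_prev i)) by rewrite !det3E; ring.
  lra.
by case/arrowP: (arrow_next hi) => + _; rewrite eq_sym.
Qed.

(** At each hull point the weighted forces of its two rim edges add up to a force along the spoke;
    the incoming edges are reindexed by [hull_prev]. *)
Lemma rim_forces v : \sum_(i | on_hull i) (rim i)^-1 * stretch p v i (hull_next i) =
  \sum_(i | on_hull i) spoke i * dot (psub (p i) o) (v i).
Proof.
transitivity (\sum_(i | on_hull i) (rim i)^-1 * dot (psub (p i) (p (hull_next i))) (v i) +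
   \sum_(i | on_hull i) (rim i)^-1 * dot (psub (p (hull_next i)) (p i)) (v (hull_next i))).
  rewrite -big_split; apply: eq_bigr => i _ /=.
  by rewrite /stretch /dot /psub /=; ring.
rewrite [X in _ + X](reindex_onto hull_prev hull_next) /=; last by move=> i; apply: prev_next.
rewrite [X in _ + X](eq_bigl on_hull); last first.
  move=> i; apply/andP/idP => [[h /eqP <-]|h]; first exact: arrow_to (arrow_next h).
  by rewrite next_prev // (arrow_from (arrow_prev h)).
rewrite -big_split; apply: eq_bigr => i hi /=; rewrite next_prev //.
have r1 := rim_gt0 hi; have r2 := rim_prev_gt0 hi.
rewrite /spoke rim_prev //; rewrite rim_prev // in r2; move: r1 r2; rewrite /rim.
rewrite !det3E /dot /psub /= => r1 r2.
field; apply/andP; split; apply: contraTneq isT => e; [move: r1|move: r2]; lra.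
Qed.

(** The internal forces of the rim do no work in a translation. *)
Lemma spoke_balance (c : pt R) : \sum_(i | on_hull i) spoke i * dot (psub (p i) o) c = 0.
Proof.
rewrite -(rim_forces (fun=> c)) big1 // => i _.
by rewrite /stretch /dot /psub /= !subrr !mulr0 addr0 mulr0.
Qed.

Lemma wheel_stress v (c : pt R) :
  \sum_(i | on_hull i) (rim i)^-1 * stretch p v i (hull_next i) =
  \sum_(i | on_hull i) spoke i * dot (psub (p i) o) (psub (v i) c).
Proof.
rewrite rim_forces -[RHS]addr0 -[X in _ = _ + X](spoke_balance c) -big_split.
apply: eq_bigr => i _.
by rewrite /dot /psub /=; ring.
Qed.

(* A virtual hub [o] is replaced by the complete graph on the hull with weights
   [spoke i * spoke j], which exerts the same forces up to a factor. *)
Lemma hubless_stress v :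
  \sum_(i | on_hull i) \sum_(j | on_hull j) spoke i * spoke j * stretch p v i j =
  2 * (\sum_(i | on_hull i) spoke i) *
  \sum_(i | on_hull i) (rim i)^-1 * stretch p v i (hull_next i).
Proof.
rewrite rim_forces.
pose T i j := spoke i * spoke j * dot (psub (p i) (p j)) (v i).
transitivity (\sum_(i | on_hull i) \sum_(j | on_hull j) T i j +
  \sum_(i | on_hull i) \sum_(j | on_hull j) T j i).
  rewrite -big_split; apply: eq_bigr => i _; rewrite -big_split; apply: eq_bigr => j _.
  by rewrite /T /stretch /dot /psub /=; ring.
rewrite [X in _ + X]exchange_big /= -mulr2n -[LHS]mulr_natl -[RHS]mulrA; congr (_ * _).
rewrite mulr_sumr; apply: eq_bigr => i _; rewrite mulr_suml.
have := congr1 ( *%R (spoke i)) (spoke_balance (v i)); rewrite mulr0 mulr_sumr => e.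
rewrite -[LHS]addr0 -[X in _ + X = _]e -big_split; apply: eq_bigr => j _.
by rewrite /T /dot /psub /=; ring.
Qed.

End Wheel.
End Hull.

Lemma is_polyhedron_fin (R : realType) n (Y : coords R n -> Prop) (J : finType)
    (A : J -> coords R n) (c : J -> R) :
  (forall x, Y x <-> forall j, \sum_e A j e * x e <= c j) -> is_polyhedron Y.
Proof.
move=> YE; exists #|J|, (fun r => A (enum_val r)), (fun r => c (enum_val r)) => x.
split=> [/YE h r|h]; first exact: h.
by apply/YE => j; have := h (enum_rank j); rewrite enum_rankK.
Qed.

Lemma pt_eq (R : realType) (u w : pt R) : u.1 = w.1 -> u.2 = w.2 -> u = w.
Proof. by case: u w => ? ? [? ?] /= -> ->. Qed.

(** * Motions with prescribed stretches *)

Section Motions.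
Variables (R : realType) (n : nat) (p : 'I_n.+2 -> pt R) (a b : pt R).
Hypothesis gp : general_position p.
Hypothesis hy : (p ord0).2 != (p (lift ord0 ord0)).2.
Local Notation det i j k := (det3 (p i) (p j) (p k)).
Local Notation i0 := (ord0 : 'I_n.+2).
Local Notation i1 := (lift ord0 ord0 : 'I_n.+2).

(** A third point would contradict general position; with only two points in all, their different
    heights separate them. *)
Lemma points_injective : injective p.
Proof.
move=> i j pij; apply/eqP/negPn/negP => ij.
have h k : k != i -> k != j -> False.
  move=> ki kj; have : det i j k != 0 by apply: gp; rewrite // eq_sym.
  rewrite pij; suff -> : det3 (p j) (p j) (p k) = 0 by rewrite eqxx.
  by rewrite det3E; ring.
have c k : (k == i) || (k == j).
  by case: (eqVneq k i) => //= ki; case: (eqVneq k j) => //= kj; case: (h k).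
have pk k : p k = p j by case/orP: (c k) => /eqP ->.
by case/eqP: hy; rewrite (pk i0) (pk i1).
Qed.

Lemma wgt_neq0 i j k l : uniq [:: i; j; k; l] -> wgt p i j k l != 0.
Proof.
rewrite /= !inE !negb_or => /and4P[/and3P[ij ik il] /andP[jk jl] kl _].
by rewrite /wgt invr_eq0 mulf_neq0 // gp.
Qed.

(** The pairs meeting the first two points determine the motion. Every other pair then follows from
    its four-point relation with these two points, where its weight is nonzero. *)
Lemma normalized_motion (d : coords R n.+2) :
  (forall i j k l, uniq [:: i; j; k; l] -> four p (dd d) i j k l = 0) ->
  exists2 v, normalized v & forall i j, i != j -> stretch p v i j = dd d i j.
Proof.
move=> d0; have n01 : i0 != i1 by [].
have hy' : (p i1).2 - (p i0).2 != 0 by rewrite subr_eq0 eq_sym.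
pose v1 : pt R := (0, dd d i0 i1 / ((p i1).2 - (p i0).2)).
(* The scalar products of [v k] with [p k - p i0] and [p k - p i1] must be [dd d i0 k] and [r k];
   Cramer's rule gives [v k]. *)
pose r k := dd d i1 k + dot (psub (p k) (p i1)) v1.
pose v k : pt R := if k == i0 then (0, 0) else if k == i1 then v1 else
  ((dd d i0 k * ((p k).2 - (p i1).2) - r k * ((p k).2 - (p i0).2)) / det k i0 i1,
   (((p k).1 - (p i0).1) * r k - ((p k).1 - (p i1).1) * dd d i0 k) / det k i0 i1).
have v0E : v i0 = (0, 0) by rewrite /v eqxx.
have v1E : v i1 = v1 by rewrite /v eq_sym (negbTE n01) eqxx.
have s01 : stretch p v i0 i1 = dd d i0 i1.
  by rewrite /stretch v0E v1E /dot /psub /v1 /=; field.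
have new k : k != i0 -> k != i1 ->
    stretch p v i0 k = dd d i0 k /\ stretch p v i1 k = dd d i1 k.
  move=> k0 k1; have D : det k i0 i1 != 0 by apply: gp.
  have vk : v k = ((dd d i0 k * ((p k).2 - (p i1).2) - r k * ((p k).2 - (p i0).2)) / det k i0 i1,
   (((p k).1 - (p i0).1) * r k - ((p k).1 - (p i1).1) * dd d i0 k) / det k i0 i1).
    by rewrite /v (negbTE k0) (negbTE k1).
  rewrite /stretch v0E v1E vk /r; move: D; rewrite det3E /dot /psub /= => D.
  by split; field; apply/andP; split; by [exact: D|exact: hy'|].
have full k l : k != i0 -> k != i1 -> l != i0 -> l != i1 -> k != l ->
    stretch p v k l = dd d k l.
  move=> k0 k1 l0 l1 kl.
  have u : uniq [:: k; l; i0; i1] by rewrite /= !inE !negb_or kl k0 k1 l0 l1.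
  have := d0 _ _ _ _ u; rewrite -(four_stretch gp v u) /four.
  have [h1 h2] := new k k0 k1; have [h3 h4] := new l l0 l1.
  rewrite !(stretch_sym p v k) !(stretch_sym p v l) h1 h2 h3 h4 s01.
  rewrite (dd_sym d i0 k) (dd_sym d i1 k) (dd_sym d i0 l) (dd_sym d i1 l).
  by move=> /addIr/addIr/addIr/addIr/addIr/(mulfI (wgt_neq0 u)) ->.
exists (v : motion R n.+2); first by rewrite /normalized v0E v1E.
move=> i j ij.
have [i_0|ni0] := eqVneq i i0.
  subst i; have [->|j1] := eqVneq j i1; first exact: s01.
  by have [] := new j _ j1; rewrite // eq_sym.
have [j_0|nj0] := eqVneq j i0.
  subst j; rewrite stretch_sym dd_sym; have [->|j1] := eqVneq i i1; first exact: s01.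
  by have [] := new i ni0 j1.
have [i_1|ni1] := eqVneq i i1.
  by subst i; have [] := new j nj0; rewrite // eq_sym.
have [j_1|nj1] := eqVneq j i1; last exact: full.
by subst j; rewrite stretch_sym dd_sym; have [] := new i ni0 ni1.
Qed.

Lemma Xbar_injective v w : Xbar a b p v -> Xbar a b p w ->
  phi a b p v = phi a b p w -> v = w.
Proof.
move=> [[v1 [v2 v3]] _] [[w1 [w2 w3]] _] e.
have {}e i j : stretch p v i j = stretch p w i j.
  have [->|ij] := eqVneq i j; first by rewrite /stretch /dot /psub /= !subrr !mul0r.
  have [q [[-> ->]|[-> ->]]] := pair_spanning ij; last rewrite !(stretch_sym _ _ (psnd q));
  by have := congr1 (@^~ q) e; rewrite /phi => /addrI/oppr_inj.
have n01 : i0 != i1 by [].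
have e0 : v i0 = w i0 by apply: pt_eq; rewrite ?v1 ?v2.
have e1 : v i1 = w i1.
  have := e i0 i1; rewrite /stretch e0 /dot /psub /= v3 w3 => /addrI.
  have h : (p i0).2 - (p i1).2 != 0 by rewrite subr_eq0.
  by move=> /(mulfI h)/addrI/oppr_inj e2; apply: pt_eq; rewrite ?v3.
apply/funext => k; have [->//|k0] := eqVneq k i0; have [->//|k1] := eqVneq k i1.
have D : det k i0 i1 != 0 by apply: gp.
have := e k i0; have := e k i1; rewrite /stretch e0 e1.
move: D; rewrite det3E /dot /psub /= => D f1 f0.
have g1 : (v k).1 = (w k).1.
  apply: (mulIf D); have := congr1 ( *%R ((p k).2 - (p i1).2)) f0.
  have := congr1 ( *%R ((p k).2 - (p i0).2)) f1; lra.
have g2 : (v k).2 = (w k).2.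
  apply: (mulIf D); have := congr1 ( *%R ((p k).1 - (p i1).1)) f0.
  have := congr1 ( *%R ((p k).1 - (p i0).1)) f1; lra.
exact: pt_eq.
Qed.
End Motions.

(** * The polyhedron of the theorem *)

Section Main.
Variables (R : realType) (n : nat) (p : 'I_n.+2 -> pt R) (a b : pt R).
Hypothesis gp : general_position p.
Hypothesis hy : (p ord0).2 != (p (lift ord0 ord0)).2.
Local Notation det i j k := (det3 (p i) (p j) (p k)).
Local Notation I := 'I_n.+2.

Lemma four_lin (g h : I -> I -> R) c i j k l :
  four p (fun i j => g i j + c * h i j) i j k l = four p g i j k l + c * four p h i j k l.
Proof. by rewrite /four; ring. Qed.

Lemma four_ext (g h : I -> I -> R) i j k l : uniq [:: i; j; k; l] ->
  (forall i j, i != j -> g i j = h i j) -> four p g i j k l = four p h i j k l.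
Proof.
rewrite /= !inE !negb_or => /and4P[/and3P[ij ik il] /andP[jk jl] kl _] gh.
by rewrite /four !gh.
Qed.

Lemma dd_phi v i j : i != j ->
  dd (phi a b p v) i j = fab a b p i j + (-1) * stretch p v i j.
Proof.
have -> : phi a b p v = fun e => fab a b p (pfst e) (psnd e) + (-1) * stretches p v e.
  by apply/funext => e; rewrite mulN1r.
move=> ij; rewrite ddD (dd_sym_fun (fab_sym p a b)) //.
by rewrite (dd_sym_fun (stretch_sym p v)).
Qed.

Lemma Yset_phi d : Yset p d <-> exists v, Xbar a b p v /\ d = phi a b p v.
Proof.
split=> [[eqs le0]|[v [[_ feas] ->]]].
  (* The relations have value one on both [fab] and [d], hence zero on [d']. *)
  pose d' : coords R n.+2 := fun e => fab a b p (pfst e) (psnd e) + (-1) * d e.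
  have d'E i j : i != j -> dd d' i j = fab a b p i j + (-1) * dd d i j.
    by move=> ij; rewrite ddD (dd_sym_fun (fab_sym p a b)).
  have [|v nv vE] := normalized_motion gp hy (d := d').
    move=> i j k l u; rewrite (four_ext u d'E) four_lin four_fab //.
    have -> : four p (dd d) i j k l = 1 := eqs _ _ _ _ u.
    by rewrite mulr1 subrr.
  exists v; have sE e : stretch p v (pfst e) (psnd e) = d' e.
    by rewrite vE ?pair_neq // dd_pair.
  split; last by apply/funext => e; rewrite /phi sE /d'; ring.
  by split=> // e; rewrite sE /d'; have := le0 e; lra.
split=> [i j k l u|e]; last by rewrite /phi subr_le0.
rewrite -[LHS]/(four p (dd (phi a b p v)) i j k l).
by rewrite (four_ext u (dd_phi v)) four_lin four_fab // four_stretch // mulr0 addr0.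
Qed.

Lemma Yset_diff x y : Yset p x -> Yset p y ->
  exists v, (fun e => y e - x e) = stretches p v.
Proof.
move=> /Yset_phi[v [_ ->]] /Yset_phi[w [_ ->]].
exists (fun i => ((v i).1 + (-1) * (w i).1, (v i).2 + (-1) * (w i).2)).
by apply/funext => e; rewrite /stretches stretchD /phi; ring.
Qed.

Lemma Yset_shift x v : Yset p x -> (forall e, x e + stretches p v e <= 0) ->
  Yset p (fun e => x e + stretches p v e).
Proof.
move=> [eqs _] le0; split=> // i j k l u.
have dE s t : s != t -> dd (fun e => x e + stretches p v e) s t =
    dd x s t + 1 * stretch p v s t.
  move=> st; under eq_fun do rewrite -[stretches p v _]mul1r.
  by rewrite ddD (dd_sym_fun (stretch_sym p v)).
rewrite -[LHS]/(four p (dd (fun e => x e + stretches p v e)) i j k l).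
rewrite (four_ext u dE) four_lin four_stretch // mulr0 addr0; exact: eqs.
Qed.

Lemma Yset_polyhedron : is_polyhedron (Yset p).
Proof.
(* Each equation becomes two inequalities, told apart by the sign [s]; quadruples with repetitions
   give [0 <= 0]. *)
pose J := ((I * I) * (I * I) * bool + pairs n.+2)%type.
pose A (q : J) : coords R n.+2 := fun e => match q with
  | inl (ij, kl, s) => if uniq [:: ij.1; ij.2; kl.1; kl.2] then
      (-1) ^+ s * four p (dd (fun e' => (e' == e)%:R)) ij.1 ij.2 kl.1 kl.2 else 0
  | inr e0 => (e0 == e)%:R end.
pose c (q : J) : R := match q with
  | inl (ij, kl, s) => if uniq [:: ij.1; ij.2; kl.1; kl.2] then (-1) ^+ s else 0
  | inr _ => 0 end.
have fE x i j k l : four p (dd x) i j k l =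
    \sum_e four p (dd (fun e' => (e' == e)%:R)) i j k l * x e.
  rewrite /four (dd_sum x i j) (dd_sum x i k) (dd_sum x i l).
  rewrite (dd_sum x j k) (dd_sum x j l) (dd_sum x k l) !mulr_sumr -!big_split.
  by apply: eq_bigr => e _ /=; ring.
have AE x i j k l s : uniq [:: i; j; k; l] ->
    \sum_e A (inl ((i, j), (k, l), s)) e * x e = (-1) ^+ s * four p (dd x) i j k l.
  by rewrite fE mulr_sumr /A => ->; apply: eq_bigr => e _; rewrite mulrA.
have Ae x e0 : \sum_e A (inr e0) e * x e = x e0.
  rewrite (bigD1 e0) //= eqxx mul1r big1 ?addr0 // => e ne.
  by rewrite eq_sym (negbTE ne) mul0r.
apply: (is_polyhedron_fin (A := A) (c := c)) => x; split=> [[eqs le0] [[[[i j] [k l]] s]|e]|h].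
- have [u|nu] := boolP (uniq [:: i; j; k; l]).
    rewrite AE //; have -> : four p (dd x) i j k l = 1 := eqs _ _ _ _ u.
    by rewrite mulr1 /c u.
  by rewrite /c (negbTE nu) big1 // => e _; rewrite /A (negbTE nu) mul0r.
- by rewrite Ae; apply: le0.
- split=> [i j k l u|e]; last by have := h (inr e); rewrite Ae.
  rewrite -[LHS]/(four p (dd x) i j k l).
  have := h (inl ((i, j), (k, l), true)); have := h (inl ((i, j), (k, l), false)).
  by rewrite !AE // /c u expr0 expr1; lra.
Qed.

Let pinj : injective p := points_injective gp hy.

Definition hull_face d := Yset p d /\
  forall e : pairs n.+2, hull_edge p (pfst e) (psnd e) -> d e = 0.

Lemma hull_face_dd d i j : hull_face d -> hull_edge p i j -> dd d i j = 0.
Proof.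
move=> [_ d0] ij; have ne : i != j by case: ij.
have [e [[ie je]|[je ie]]] := pair_spanning ne; subst i j.
  by rewrite dd_pair d0.
by rewrite dd_sym dd_pair d0 //; apply: hull_edge_sym.
Qed.

Lemma hull_face_motion d : hull_face d ->
  exists v, forall i j, stretch p v i j = fab a b p i j - dd d i j.
Proof.
move=> [/Yset_phi[v [_ ->]] _]; exists v => i j.
have [->|ij] := eqVneq i j; last by rewrite dd_phi //; ring.
by rewrite dd_diag /stretch /fab /dot /psub !det3E /=; ring.
Qed.

(** * Boundedness of the hull face *)

Definition face_bounded i j := exists M, forall d, hull_face d -> `|dd d i j| <= M.

Lemma face_bounded_sym i j : face_bounded i j -> face_bounded j i.
Proof. by case=> M h; exists M => d /h; rewrite dd_sym. Qed.

Lemma face_bounded_hull_edge i j : hull_edge p i j -> face_bounded i j.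
Proof. by move=> ij; exists 0 => d Fd; rewrite (hull_face_dd Fd ij) normr0. Qed.

Lemma rim_stretch o d v : hull_face d ->
  (forall i j, stretch p v i j = fab a b p i j - dd d i j) ->
  \sum_(i | on_hull p i) (rim p o i)^-1 * stretch p v i (hull_next p i) =
  \sum_(i | on_hull p i) (rim p o i)^-1 * fab a b p i (hull_next p i).
Proof.
move=> Fd vE; apply: eq_bigr => i hi.
by rewrite vE (hull_face_dd Fd (arrow_hull (arrow_next hi))) subr0.
Qed.

(** On the hull face the stretches of the rim are fixed, so the wheel with hub [p l] fixes a
    positive combination of the nonnegative numbers [- dd d i l]. *)
Lemma face_bounded_spoke i l : on_hull p i -> ~~ on_hull p l -> face_bounded i l.
Proof.
move=> hi hl.
have rpos k : on_hull p k -> 0 < rim p (p l) k.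
  move=> hk; rewrite /rim det_rot; have ak := arrow_next hk.
  have [_] := arrowP _ _ _ ak; apply.
    by apply: contraNneq hl => ->.
  by apply: contraNneq hl => ->; apply: arrow_to ak.
pose s := spoke p (p l).
have sp k : on_hull p k -> 0 < s k by apply: spoke_gt0.
pose K := \sum_(i | on_hull p i) s i * fab a b p i l -
  \sum_(i | on_hull p i) (rim p (p l) i)^-1 * fab a b p i (hull_next p i).
exists (- K / s i) => d Fd.
have [v vE] := hull_face_motion Fd.
have := wheel_stress gp pinj rpos v (v l); rewrite (rim_stretch _ Fd vE).
have -> : \sum_(i | on_hull p i) spoke p (p l) i * dot (psub (p i) (p l)) (psub (v i) (v l)) =
    \sum_(i | on_hull p i) s i * fab a b p i l + \sum_(i | on_hull p i) s i * - dd d i l.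
  rewrite -big_split; apply: eq_bigr => k _ /=.
  by rewrite -mulrDr -vE.
move=> e; have {}e : - K = \sum_(i | on_hull p i) s i * - dd d i l by rewrite /K e; ring.
have Yd : Yset p d by case: Fd.
rewrite ler0_norm ?(dd_le0 Yd) // ler_pdivlMr ?sp // mulrC e (bigD1 i) //= lerDl.
by apply: sumr_ge0 => k /andP[hk _]; rewrite mulr_ge0 ?oppr_ge0 ?(dd_le0 Yd) // ltW ?sp.
Qed.

(** A pair that is not a hull edge forces at least three points; this keeps the centroid off every
    hull edge. *)
Lemma third_point i j : i != j -> ~ hull_edge p i j -> forall s t, exists k, k != s /\ k != t :> I.
Proof.
move=> ij nh s t; apply: contrapT => none.
have [k [ki kj]] : exists k, k != i /\ k != j.
  apply: contrapT => nk; apply: nh; split=> //; left=> k ki kj.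
  by exfalso; apply: nk; exists k.
have sub u : (u == s) || (u == t).
  by apply/negPn/negP; rewrite negb_or => /andP[us ut]; apply: none; exists u.
move: ij ki kj; case/orP: (sub i) => /eqP ->; case/orP: (sub j) => /eqP ->;
  case/orP: (sub k) => /eqP ->; by rewrite ?eqxx.
Qed.

Lemma face_bounded_on_hull i j : i != j -> on_hull p i -> on_hull p j -> face_bounded i j.
Proof.
move=> ij hi hj; have [hij|nh] := pselect (hull_edge p i j).
  exact: face_bounded_hull_edge.
pose N : R := #|I|%:R.
have N0 : 0 < N by rewrite ltr0n card_ord.
(* The centroid: its [rim] is the mean of the areas spanned by all points, none negative and one
   positive. *)
pose o : pt R := (N^-1 * \sum_k (p k).1, N^-1 * \sum_k (p k).2).
have oE s t : N * det3 o (p s) (p t) = \sum_k det k s t.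
  under [RHS]eq_bigr => k _.
    have -> : det k s t = (det3 (0, 0) (p s) (p t) + ((p s).2 - (p t).2) * (p k).1)
        + ((p t).1 - (p s).1) * (p k).2 by rewrite !det3E /=; ring.
    over.
  rewrite !big_split /= -!mulr_sumr sumr_const -/N -[X in X + _ + _]mulr_natl -/N.
  by rewrite !det3E /o /=; field; apply: lt0r_neq0.
have rpos k : on_hull p k -> 0 < rim p o k.
  move=> hk; have /arrowP[_ side] := arrow_next hk.
  rewrite -(pmulr_rgt0 _ N0) oE.
  have [m [mk mn]] := third_point ij nh k (hull_next p k).
  have det_ge0 q : 0 <= det q k (hull_next p k).
    have [->|qk] := eqVneq q k.
      by have -> : det k k (hull_next p k) = 0 by rewrite det3E; ring.
    have [->|qn] := eqVneq q (hull_next p k); last by rewrite det_rot ltW ?side.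
    by have -> : det (hull_next p k) k (hull_next p k) = 0 by rewrite det3E; ring.
  rewrite (bigD1 m) //=; apply: ltr_wpDr; first by apply: sumr_ge0 => q _; apply: det_ge0.
  by rewrite det_rot; apply: side.
pose s := spoke p o.
have sp k : on_hull p k -> 0 < s k by apply: spoke_gt0.
pose K := \sum_(i | on_hull p i) \sum_(j | on_hull p j) s i * s j * fab a b p i j -
  2 * (\sum_(i | on_hull p i) s i) *
  \sum_(i | on_hull p i) (rim p o i)^-1 * fab a b p i (hull_next p i).
have sij : 0 < s i * s j by rewrite mulr_gt0 ?sp.
exists (- K / (s i * s j)) => d Fd.
have [v vE] := hull_face_motion Fd.
have Yd : Yset p d by case: Fd.
have := hubless_stress gp pinj rpos v; rewrite (rim_stretch _ Fd vE).
have -> : \sum_(i | on_hull p i) \sum_(j | on_hull p j)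
      spoke p o i * spoke p o j * stretch p v i j =
    \sum_(i | on_hull p i) \sum_(j | on_hull p j) s i * s j * fab a b p i j +
    \sum_(i | on_hull p i) \sum_(j | on_hull p j) s i * s j * - dd d i j.
  rewrite -big_split; apply: eq_bigr => k _; rewrite -big_split; apply: eq_bigr => m _ /=.
  by rewrite -mulrDr -vE.
move=> e.
have {}e : - K = \sum_(i | on_hull p i) \sum_(j | on_hull p j) s i * s j * - dd d i j.
  by rewrite /K -e; ring.
have term k m : on_hull p k -> on_hull p m -> 0 <= s k * s m * - dd d k m.
  move=> hk hm; apply: mulr_ge0; last by rewrite oppr_ge0 (dd_le0 Yd).
  by apply: mulr_ge0; apply/ltW/sp.
rewrite ler0_norm ?(dd_le0 Yd) // ler_pdivlMr // mulrC e (bigD1 i) //= (bigD1 j) //=.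
rewrite -addrA lerDl addr_ge0 //; first by apply: sumr_ge0 => k /andP[hk _]; apply: term.
by apply: sumr_ge0 => k /andP[hk _]; apply: sumr_ge0 => m hm; apply: term.
Qed.

Lemma face_bounded_four i j k l : uniq [:: i; j; k; l] ->
  face_bounded i j -> face_bounded i k -> face_bounded i l ->
  face_bounded j k -> face_bounded j l -> face_bounded k l.
Proof.
move=> u [M1 b1] [M2 b2] [M3 b3] [M4 b4] [M5 b5].
pose q1 := wgt p i j k l; pose q2 := wgt p i k j l; pose q3 := wgt p i l j k.
pose q4 := wgt p j k i l; pose q5 := wgt p j l i k; pose q6 := wgt p k l i j.
have q6n : 0 < `|q6|.
  rewrite normr_gt0; apply: (wgt_neq0 gp).
  by rewrite (perm_uniq (_ : perm_eq _ [:: i; j; k; l])) // (perm_catC [:: k; l]).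
exists ((1 + `|q1| * M1 + `|q2| * M2 + `|q3| * M3 + `|q4| * M4 + `|q5| * M5) / `|q6|) => d Fd.
rewrite ler_pdivlMr // mulrC -normrM.
have -> : q6 * dd d k l = 1 - q1 * dd d i j - q2 * dd d i k - q3 * dd d i l
    - q4 * dd d j k - q5 * dd d j l.
  by have [[eqs _] _] := Fd; rewrite -(eqs _ _ _ _ u) /q1 /q2 /q3 /q4 /q5 /q6; ring.
do 5! (apply: le_trans (ler_normB _ _) _; apply: lerD;
  last by rewrite normrM ler_wpM2l ?normr_ge0 ?b1 ?b2 ?b3 ?b4 ?b5).
by rewrite normr1.
Qed.

Lemma face_bounded_all i j : i != j -> face_bounded i j.
Proof.
move=> ij.
have [hi|hi] := boolP (on_hull p i); have [hj|hj] := boolP (on_hull p j).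
- exact: face_bounded_on_hull.
- exact: face_bounded_spoke.
- by apply: face_bounded_sym; apply: face_bounded_spoke.
(* For two inner points, the relation with the ends of a hull edge has its five other pairs already
   bounded. *)
have [s [t st]] := hull_nonempty gp pinj ij.
have hs := arrow_from st; have ht := arrow_to gp pinj st.
have ne : s != t by case/arrowP: st.
have neq k l : on_hull p k -> ~~ on_hull p l -> k != l.
  by move=> hk; apply: contraNneq => <-.
apply: (@face_bounded_four s t i j); try exact: face_bounded_spoke.
  by rewrite /= !inE !negb_or ne ij !neq.
exact/face_bounded_hull_edge/arrow_hull.
Qed.

Lemma hull_face_bounded : bounded hull_face.
Proof.
have /choice[M MP] : forall e : pairs n.+2, exists M, forall d, hull_face d -> `|d e| <= M.
  move=> e; have [M bM] := face_bounded_all (pair_neq e).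
  by exists M => d /bM; rewrite dd_pair.
exists (\sum_e `|M e|) => d Fd e.
apply: le_trans (MP e d Fd) _; apply: le_trans (ler_norm _) _.
by rewrite (bigD1 e) //= lerDl sumr_ge0.
Qed.

Definition stretch_space (g : coords R n.+2) := exists v, g = stretches p v.

Lemma stretch_space0 : stretch_space (fun=> 0).
Proof.
exists (fun=> (0, 0)); apply/funext => e.
by rewrite /stretches /stretch /dot /psub /=; ring.
Qed.

Lemma stretch_spaceD c g h : stretch_space g -> stretch_space h ->
  stretch_space (fun e => g e + c * h e).
Proof.
move=> [v ->] [w ->]; exists (fun i => ((v i).1 + c * (w i).1, (v i).2 + c * (w i).2)).
by apply/funext => e; rewrite /stretches stretchD.
Qed.

Lemma Yset_step x g : Yset p x -> stretch_space g -> (forall e, x e + g e <= 0) ->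
  Yset p (fun e => x e + g e).
Proof. by move=> Yx [v ->]; apply: Yset_shift. Qed.

Lemma stretch_space_surjective x (t : coords R n.+2) : Yset p x ->
  exists2 g, stretch_space g &
    forall e, x e = 0 \/ hull_edge p (pfst e) (psnd e) -> g e = t e.
Proof.
move=> Yx; have [v vE] := taut_surjective gp pinj Yx t.
by exists (stretches p v) => //; exists v.
Qed.

Lemma Yset_le0 x e : Yset p x -> x e <= 0.
Proof. by case. Qed.

End Main.

Theorem theorem5p3 (R : realType) (n : nat) (p : 'I_n.+2 -> pt R) (a b : pt R)
  (hgp : general_position p)
  (hy : (p ord0).2 != (p (lift ord0 ord0)).2) :
  let Y := Yset p in
  let F := fun d => Y d /\ forall e : pairs n.+2, hull_edge p (pfst e) (psnd e) -> d e = 0 in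
  [/\ simple_polyhedron Y,
      (* affine isomorphism Xbar_f(P) -> Y via v |-> d *)
      (forall v w, Xbar a b p v -> Xbar a b p w -> phi a b p v = phi a b p w -> v = w),
      (forall d, Y d <-> exists v, Xbar a b p v /\ d = phi a b p v),
      (* F is the unique maximal bounded face of Y *)
      [/\ bounded_face Y F,
          (forall G, bounded_face Y G -> psubset F G -> G = F) &
          (forall G, bounded_face Y G ->
             (forall H, bounded_face Y H -> psubset G H -> H = G) -> G = F)] &
      (* F is affinely isomorphic to X_f(P) via the same map *)
      (forall d, F d <-> exists v, Xf a b p v /\ d = phi a b p v)].
Proof.
move=> Y F.
have surj := stretch_space_surjective hgp hy.
have YB := Yset_diff a b hgp hy.
have bF : bounded_face Y F.
  split; last exact: (hull_face_bounded a b hgp hy).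
  exact: (tight_face (@Yset_le0 _ _ p)).
(* Every bounded face lies in [F]; maximality and uniqueness both follow. *)
have sub G : bounded_face Y G -> psubset G F.
  move=> bG x Gx; split.
    by case: bG => -[c [c0 [_ E]]] _; move: Gx; rewrite E => -[].
  move=> e he; apply: (bounded_face_tight (stretch_space0 p) (@stretch_spaceD _ _ p)
    (Yset_step hgp) (@Yset_le0 _ _ p) surj bG Gx he).
have antisym G : psubset G F -> psubset F G -> G = F.
  by move=> GF FG; apply/funext => x; apply/propext; split; [apply: GF|apply: FG].
split.
- exact: (simple_of_surjective (stretch_space0 p) (@stretch_spaceD _ _ p) YB
    (Yset_step hgp) (@Yset_le0 _ _ p) surj (Yset_polyhedron p)).
- exact: (Xbar_injective hgp hy).
- by move=> d; apply: Yset_phi.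
- split=> // G bG; first by move=> FG; apply: antisym => //; apply: sub.
  by move=> maxG; apply/esym/maxG => //; apply: sub.
- move=> d; split=> [[Yd d0]|[v [[Xv he] ->]]].
    have [v [Xv dE]] := (Yset_phi a b hgp hy d).1 Yd.
    exists v; split=> //; split=> // e he.
    by have := d0 e he; rewrite dE /phi => /eqP; rewrite subr_eq0 => /eqP.
  split; first by apply/(Yset_phi a b hgp hy); exists v.
  by move=> e h; rewrite /phi (he e h) subrr.
Qed.
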